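(* Let $d,n\in\mathbb{N}$, $q\in(-1,1)$, let $\varepsilon=(\varepsilon(1),\dots,\varepsilon(2n))\in\mathcal{D}_{(1,* )}(2n)$ be a tuple with the Dyck property, and let $u_1,\dots,u_{2n}\in\mathbb{C}^d$. Consider the product of $2n$ alternating right/left operators $$M:=R^{\varepsilon(2n)}(u_{2n})\,L^{\varepsilon(2n-1)}(u_{2n-1})\cdots R^{\varepsilon(2)}(u_2)\,L^{\varepsilon(1)}(u_1)\in B(\mathcal{T}_{d;q}).$$ Then $$M(\xi_{\mathrm{vac}})=\sum_{\pi\in\Phi_n^{-1}(\varepsilon)}\Bigl[q^{\mathrm{cr}(\pi)}\cdot\prod_{\substack{\{k,h\}\text{ pair in }\underline{s}_n\cdot\pi\\ \text{with }\varepsilon(h)=*,\ \varepsilon(k)=1}}\langle u_k,u_h\rangle\Bigr]\cdot\xi_{\mathrm{vac}}.$$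
   Context: $\mathbb{N}=\{1,2,3,\dots\}$; inner products are linear in the first variable; $0^0=1$. $q$-Fock space. For $n\in\mathbb{N}$, equip $(\mathbb{C}^d)^{\otimes n}$ with the inner product determined by $\langle v_1\otimes\cdots\otimes v_n, w_1\otimes\cdots\otimes w_n\rangle_q=\sum_{\tau\in S_n} q^{\iota(\tau)}\prod_{i=1}^n\langle v_i,w_{\tau(i)}\rangle$, where $\iota(\tau)$ is the number of inversions of $\tau$ (this is known to be an inner product). $\mathcal{T}_{d;q}$ is the Hilbert space orthogonal direct sum $\mathbb{C}\oplus\bigoplus_{n\ge1}(\mathbb{C}^d)^{\otimes n}$; the vector $1\in\mathbb{C}$ is the vacuum vector $\xi_{\mathrm{vac}}$. For $v\in\mathbb{C}^d$, $L(v),R(v)\in B(\mathcal{T}_{d;q})$ are the (bounded) operators determined by $L(v)\xi_{\mathrm{vac}}=v=R(v)\xi_{\mathrm{vac}}$, $L(v)(v_1\otimes\cdots\otimes v_n)=v\otimes v_1\otimes\cdots\otimes v_n$, $R(v)(v_1\otimes\cdots\otimes v_n)=v_1\otimes\cdots\otimes v_n\otimes v$. Put $L^1(v)=L(v)$, $R^1(v)=R(v)$, and let $L^*(v),R^*(v)$ be the adjoints of $L(v),R(v)$. Combinatorics. $\mathcal{P}_2(2n)$ is the set of pair-partitions of $\{1,\dots,2n\}$ (partitions into $n$ blocks of size 2). Two distinct blocks of $\pi\in\mathcal{P}_2(2n)$ cross if, writing their union as $\{a<b<c<d\}$, one block is $\{a,c\}$ and the other $\{b,d\}$; $\mathrm{cr}(\pi)$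 is the number of unordered pairs of crossing blocks. $\underline{s}_n$ is the permutation of $\{1,\dots,2n\}$ with $\underline{s}_n(k)=2k-1$ for $1\le k\le n$ and $\underline{s}_n(k)=2(2n+1-k)$ for $n+1\le k\le 2n$; it acts on $\mathcal{P}_2(2n)$ by $\underline{s}_n\cdot\{V_1,\dots,V_n\}=\{\underline{s}_n(V_1),\dots,\underline{s}_n(V_n)\}$. $\mathcal{D}_{(1,* )}(2n)$ is the set of $\varepsilon:\{1,\dots,2n\}\to\{1,*\}$ with $|\{i\le h:\varepsilon(i)=1\}|\ge|\{i\le h:\varepsilon(i)=*\}|$ for all $1\le h\le2n$, with equality for $h=2n$. The map $\Phi_n:\mathcal{P}_2(2n)\to\mathcal{D}_{(1,* )}(2n)$ sends $\pi$ to the tuple $\varepsilon$ defined as follows: writing $\underline{s}_n\cdot\pi=\{W_1,\dots,W_n\}$, $\varepsilon(\min W_i)=1$ and $\varepsilon(\max W_i)=*$ for all $1\le i\le n$. *)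

(* Defs.v *)
From HB Require Import structures.
From mathcomp Require Import all_boot all_order all_fingroup all_algebra.
From mathcomp Require Import complex.
From mathcomp Require Import zify ring lra.
From mathcomp Require Import mathcomp_extra boolp classical_sets functions reals topology normedtype sequences.
Set Implicit Arguments. Unset Strict Implicit. Unset Printing Implicit Defensive.
Import Order.TTheory GRing.Theory Num.Theory numFieldNormedType.Exports.
Import GroupScope.
Local Open Scope complex_scope.
Local Open Scope ring_scope.

(* The Fock space C (+) (+)_(n >= 1) (C^d)^{(x) n} is coded by coefficients in the
   standard basis: a function [f : seq 'I_d -> R[i]] stands for the family whose
   degree-n component has f w as coefficient of e_{w_1} (x) ... (x) e_{w_n}, for w
   a word of length n; the empty word carries the vacuum component. Inner products
   are linear in the first variable. *)

Definition inversions n (s : 'S_n) : nat :=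
  #|[set p : 'I_n * 'I_n | (p.1 < p.2)%N && (s p.2 < s p.1)%N]|.

Definition permw d n (s : 'S_n) (w : n.-tuple 'I_d) : n.-tuple 'I_d :=
  [tuple tnth w (s i) | i < n].

Arguments permw : simpl never.

Lemma permwM d n (s t : 'S_n) (w : n.-tuple 'I_d) :
  permw s (permw t w) = permw (s * t)%g w.
Proof. by apply: eq_from_tnth => i; rewrite !tnth_mktuple permM. Qed.

Lemma permw1 d n (w : n.-tuple 'I_d) : permw 1%g w = w.
Proof. by apply: eq_from_tnth => i; rewrite !tnth_mktuple perm1. Qed.

Lemma permw_bij d n (s : 'S_n) : bijective (@permw d n s).
Proof.
by exists (permw s^-1%g) => w; rewrite permwM ?mulgV ?mulVg permw1.
Qed.

Lemma inversionsE n (s : 'S_n) :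
  inversions s = (\sum_(i < n) \sum_(j < n) ((i < j) && (s j < s i)))%N.
Proof.
rewrite /inversions -sum1dep_card pair_big /= big_mkcond /=.
by apply: eq_bigr => -[i j] _ /=; case: ifP.
Qed.

Lemma double_sym n (D : rel 'I_n) : symmetric D -> irreflexive D ->
  ((\sum_(i < n) \sum_(j < n) ((i < j) && D i j)).*2
   = \sum_(i < n) \sum_(j < n) D i j)%N.
Proof.
move=> Ds Di; rewrite -addnn {2}exchange_big /= -big_split /=.
apply: eq_bigr => i _; rewrite -big_split; apply: eq_bigr => j _ /=.
rewrite (Ds j i); case: (ltngtP i j) => //= [_|/val_inj ->]; last by rewrite Di.
by rewrite addn0.
Qed.

Lemma double_inversions n (s : 'S_n) :
  ((inversions s).*2 = \sum_(i < n) \sum_(j < n) ((i < j) (+) (s i < s j)))%N.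
Proof.
rewrite -double_sym.
- rewrite inversionsE; congr _.*2; apply: eq_bigr => i _; apply: eq_bigr => j _.
  case: ltngtP => //= ij; case: ltngtP => //= /val_inj/perm_inj e.
  by rewrite e ltnn in ij.
- move=> i j; case: (ltngtP i j) => [||/val_inj->] //.
    by move=> ij; case: ltngtP => //= /val_inj/perm_inj e; rewrite e ltnn in ij.
  by move=> ij; case: ltngtP => //= /val_inj/perm_inj e; rewrite e ltnn in ij.
- by move=> i; rewrite !ltnn.
Qed.

Definition asc n (r : 'S_n) : rel 'I_n :=
  fun x y => (x < y)%N && (r^-1%g x < r^-1%g y)%N.

Lemma inversions_quot n (r s : 'S_n) :
  inversions (r * s^-1)%g = (\sum_(x < n) \sum_(y < n) (asc r x y (+) asc s x y))%N.
Proof.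
apply: double_inj; rewrite double_inversions.
rewrite (reindex_inj (@perm_inj _ r^-1%g)) /=.
under eq_bigr => x _ do rewrite (reindex_inj (@perm_inj _ r^-1%g)) /=.
pose D : rel 'I_n := fun x y => (r^-1%g x < r^-1%g y)%N (+) (s^-1%g x < s^-1%g y)%N.
transitivity (\sum_(x < n) \sum_(y < n) D x y)%N.
  by apply: eq_bigr => x _; apply: eq_bigr => y _; rewrite !permM !permKV.
rewrite -double_sym.
- congr _.*2; apply: eq_bigr => x _; apply: eq_bigr => y _; rewrite /asc /D.
  by case: ltnP.
- move=> x y; rewrite /D; case: (eqVneq x y) => [->//|xy].
  have h (t : 'S_n) : (t x < t y)%N = ~~ (t y < t x)%N.
    by rewrite -leqNgt ltn_neqAle [X in X && _](_ : _ = true)// (inj_eq val_inj) (inj_eq perm_inj).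
  by rewrite !h addbN addNb negbK.
- by move=> x; rewrite /D !ltnn.
Qed.

Lemma inversions_lift n (k : 'I_n.+1) (r : 'S_n) :
  inversions (lift_perm ord0 k r) = (k + inversions r)%N.
Proof.
rewrite !inversionsE big_ord_recl; congr addn.
  rewrite big_ord_recl ltnn add0n.
  under eq_bigr => j _ do rewrite lift_perm_id lift_perm_lift /=.
  transitivity (\sum_(j < n) (bump k j < k))%N.
    by rewrite [RHS](reindex_inj (@perm_inj _ r)).
  under eq_bigr => j _.
    have -> : (bump k j < k)%N = (j < k)%N.
      rewrite /bump; case: (leqP k j) => h; last by rewrite add0n.
      by apply/negbTE; rewrite -leqNgt (leq_trans h) // add1n.
    over.
  rewrite /= -(big_mkord xpredT (fun j => nat_of_bool (j < k)%N)).
  rewrite (big_cat_nat (n := k)) ?leq0n//=; last by rewrite -ltnS.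
  rewrite [X in (_ + X)%N]big_nat_cond [X in (_ + X)%N]big1 ?addn0.
    rewrite big_nat_cond (eq_bigr (fun=> 1%N)) ?sum_nat_const_nat => [|i].
      by rewrite -big_nat_cond sum_nat_const_nat subn0 muln1.
    by rewrite andbT => /andP[_ ->].
  by move=> i /andP[/andP[ki _] _]; rewrite ltnNge ki.
apply: eq_bigr => i _; rewrite big_ord_recl /= add0n.
apply: eq_bigr => j _; rewrite !lift_perm_lift /= /bump !add1n ltnS.
congr (nat_of_bool (_ && _)).
by case: (leqP k (r i)); case: (leqP k (r j)); rewrite ?add0n ?add1n ?ltnS //; lia.
Qed.

Definition revp n : 'S_n := perm (@rev_ord_inj n).

Lemma inversions_rev n (s : 'S_n) : inversions (revp n * s * revp n)%g = inversions s.
Proof.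
apply: double_inj; rewrite !double_inversions.
rewrite (reindex_inj (@rev_ord_inj n)) /=.
under eq_bigr => x _ do rewrite (reindex_inj (@rev_ord_inj n)) /=.
rewrite exchange_big; apply: eq_bigr => i _; apply: eq_bigr => j _ /=.
rewrite !permM !permE !rev_ordK /=; congr (nat_of_bool (_ (+) _)).
  by have := ltn_ord i; have := ltn_ord j; lia.
by have := ltn_ord (s i); have := ltn_ord (s j); lia.
Qed.

Lemma prodrDE (A : comNzRingType) (I : finType) (F G : I -> A) :
  \prod_i (F i + G i) = \sum_(J : {set I}) \prod_i (if i \in J then F i else G i).
Proof. by rewrite bigA_distr; apply: eq_bigl => J; rewrite inE. Qed.

Lemma sign_kernel (F : numFieldType) (x : F) (a b : bool) :
  x ^+ (a (+) b) = (1 - x) / 2 * ((-1) ^+ a * (-1) ^+ b) + (1 + x) / 2.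
Proof. by case: a; case: b; rewrite /= ?expr0 ?expr1; field. Qed.

Section Algebra.
Variables (R : realType) (d : nat) (q : R).
Local Notation C := R[i].
Local Notation coeffs := (seq 'I_d -> C^o).
Implicit Types (f g : coeffs).

Definition cdot (v w : 'rV[C]_d) : C := \sum_(i < d) v 0 i * (w 0 i)^*.

(* The q-inner product of the degree-n components, i.e. the sesquilinear extension
   of <v_1 (x) ... (x) v_n, w_1 (x) ... (x) w_n>_q
     = \sum_s q ^ inversions(s) \prod_i <v_i, w_(s i)>; see [tensor_dot_tensor]. *)
Definition tensor_dot n (f g : seq 'I_d -> C) : C :=
  \sum_(s : 'S_n) (q%:C) ^+ inversions s *
    \sum_(w : n.-tuple 'I_d) f (permw s w) * (g w)^*.

Definition tensor_norm2 n f : R := complex.Re (tensor_dot n f f).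

Lemma eq_tensor_dot n f f' g g' : (forall w, size w = n -> f w = f' w) ->
  (forall w, size w = n -> g w = g' w) -> tensor_dot n f g = tensor_dot n f' g'.
Proof.
move=> hf hg; apply: eq_bigr => s _; congr (_ * _); apply: eq_bigr => w _.
by rewrite hf ?hg ?size_tuple.
Qed.

Lemma tensor_dotDl n f f' g : tensor_dot n (f + f') g = tensor_dot n f g + tensor_dot n f' g.
Proof.
rewrite /tensor_dot -big_split; apply: eq_bigr => s _ /=; rewrite -mulrDr -big_split.
by congr (_ * _); apply: eq_bigr => w _ /=; rewrite mulrDl.
Qed.

Lemma tensor_dotZl n a f g : tensor_dot n (a *: f) g = a * tensor_dot n f g.
Proof.
rewrite /tensor_dot mulr_sumr; apply: eq_bigr => s _; rewrite mulrCA; congr (_ * _).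
by rewrite mulr_sumr; apply: eq_bigr => w _; rewrite mulrA.
Qed.

Lemma inversionsV n (s : 'S_n) : inversions s^-1%g = inversions s.
Proof.
apply: double_inj; rewrite !double_inversions.
rewrite (reindex_inj (@perm_inj _ s)) /=; apply: eq_bigr => i _.
rewrite (reindex_inj (@perm_inj _ s)) /=; apply: eq_bigr => j _.
by rewrite !permK addbC.
Qed.

Lemma tensor_dotC n f g : tensor_dot n f g = (tensor_dot n g f)^*.
Proof.
rewrite /tensor_dot rmorph_sum (reindex_inj (@invg_inj _)); apply: eq_bigr => s _.
rewrite rmorphM inversionsV; congr (_ * _).
  by rewrite rmorphXn; congr (_ ^+ _); apply/esym/conjc_real.
rewrite rmorph_sum (reindex (permw s)); last exact/onW_bij/permw_bij.
by apply: eq_bigr => w _; rewrite permwM mulVg permw1 rmorphM /= conjCK mulrC.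
Qed.

Lemma tensor_dotDr n f g g' : tensor_dot n f (g + g') = tensor_dot n f g + tensor_dot n f g'.
Proof. by rewrite tensor_dotC tensor_dotDl rmorphD /= -!tensor_dotC. Qed.

Lemma tensor_dotZr n a f g : tensor_dot n f (a *: g) = a^* * tensor_dot n f g.
Proof. by rewrite tensor_dotC tensor_dotZl rmorphM /= -tensor_dotC. Qed.

Lemma kernelE n (r s : 'S_n) :
  (q%:C) ^+ inversions (r * s^-1)%g =
  \sum_(J : {set 'I_n * 'I_n})
    (\prod_p if p \in J then (1 - q%:C) / 2 else (1 + q%:C) / 2) *
    (\prod_(p in J) (-1) ^+ asc r p.1 p.2) * (\prod_(p in J) (-1) ^+ asc s p.1 p.2).
Proof.
rewrite inversions_quot pair_big /= -prodrXr.
transitivity (\prod_(p : 'I_n * 'I_n)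
  ((1 - q%:C) / 2 * ((-1) ^+ asc r p.1 p.2 * (-1) ^+ asc s p.1 p.2) + (1 + q%:C) / 2)).
  by apply: eq_bigr => p _; rewrite sign_kernel.
etransitivity; first exact: prodrDE.
apply: eq_bigr => J _.
rewrite -mulrA -[X in _ = _ * X]big_split /= [X in _ = _ * X]big_mkcond -big_split /=.
by apply: eq_bigr => p _; case: ifP => _ //; rewrite mulr1.
Qed.

Hypothesis hq : -1 < q < 1.

Lemma tensor_dot_ge0 n f : 0 <= tensor_dot n f f.
Proof.
suff : 0 <= tensor_dot n f f *+ n`!.
  by rewrite pmulrn_lge0 // fact_gt0.
have -> : tensor_dot n f f *+ n`! = \sum_(s : 'S_n) \sum_(r : 'S_n)
    (q%:C) ^+ inversions (r * s^-1)%g *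
    \sum_(w : n.-tuple 'I_d) f (permw r w) * (f (permw s w))^*.

  rewrite -{1}card_Sn -sumr_const; apply: eq_big => [s|s _]; first by rewrite inE.
  rewrite /tensor_dot (reindex_inj (@mulIg _ s^-1%g)); apply: eq_bigr => r _; congr (_ * _).
  rewrite (reindex (permw s)); last exact/onW_bij/permw_bij.
  by apply: eq_bigr => w _; rewrite permwM mulgKV.
under eq_bigr => s _ do under eq_bigr => r _ do rewrite kernelE mulr_suml.
under eq_bigr => s _ do rewrite exchange_big /=.
rewrite exchange_big sumr_ge0 //= => J _.
pose c : C := \prod_p if p \in J then (1 - q%:C) / 2 else (1 + q%:C) / 2.
pose chi (r : 'S_n) : C := \prod_(p in J) (-1) ^+ asc r p.1 p.2.
have chiJ r : (chi r)^* = chi r.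
  by rewrite /chi rmorph_prod /=; apply: eq_bigr => p _; rewrite rmorphXn rmorphN1.
rewrite (_ : \sum_s _ = c * \sum_(w : n.-tuple 'I_d)
   (\sum_r chi r * f (permw r w)) * (\sum_s chi s * f (permw s w))^*).
  apply: mulr_ge0; last by apply: sumr_ge0 => w _; rewrite mul_conjC_ge0.
  case/andP: hq => q1 q2.
  apply: prodr_ge0 => p _; case: ifP => _; rewrite divr_ge0 // -[1]/(1%:C).
    by rewrite -rmorphB /= lecR subr_ge0 ltW.
  by rewrite -rmorphD /= lecR -lerBlDl sub0r ltW.
rewrite mulr_sumr.
transitivity (\sum_(w : n.-tuple 'I_d) \sum_r \sum_s
    c * (chi r * f (permw r w) * (chi s * f (permw s w))^*)).
  rewrite [RHS]exchange_big [RHS](eq_bigr _ (fun r _ => exchange_big _ _ _ _ _ _)) [RHS]exchange_big.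
  apply: eq_bigr => s _; apply: eq_bigr => r _.
  rewrite mulr_sumr; apply: eq_bigr => w _.
  by rewrite rmorphM /= chiJ -/c -/(chi r) -/(chi s); ring.
apply: eq_bigr => w _; rewrite rmorph_sum big_distrlr mulr_sumr /=.
by apply: eq_bigr => r _; rewrite mulr_sumr.
Qed.

Definition lcreate (v : 'rV[C]_d) f : coeffs :=
  fun w => (if w is i :: w' then v 0 i * f w' else 0) : C.

Definition insertw (k : nat) (a : 'I_d) (w : seq 'I_d) := take k w ++ a :: drop k w.

(* The formal adjoint of [lcreate], used to bound it and to show that its Hilbert
   space adjoint exists. *)
Definition lannih (v : 'rV[C]_d) f : coeffs :=
  fun w => (\sum_(k < (size w).+1) (q%:C) ^+ k *
             \sum_(a < d) (v 0 a)^* * f (insertw k a w)) : C.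

Definition instup n (k : 'I_n.+1) (p : 'I_d * n.-tuple 'I_d) : n.+1.-tuple 'I_d :=
  [tuple if unlift k j is Some j' then tnth p.2 j' else p.1 | j < n.+1].

Lemma instup_bij n (k : 'I_n.+1) : bijective (@instup n k).
Proof.
exists (fun w => (tnth w k, [tuple tnth w (lift k j) | j < n])).
  move=> [a w]; congr pair; first by rewrite tnth_mktuple unlift_none.
  by apply: eq_from_tnth => i; rewrite !tnth_mktuple liftK.
move=> w; apply: eq_from_tnth => i; rewrite !tnth_mktuple.
by case: unliftP => [j ->|->] //; rewrite tnth_mktuple.
Qed.

Lemma instupE n (k : 'I_n.+1) a (w : n.-tuple 'I_d) :
  instup k (a, w) = insertw k a w :> seq _.
Proof.
have kn : (k <= n)%N by rewrite -ltnS.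
have hk : size (take k w) = k by rewrite size_takel // size_tuple.
apply: (@eq_from_nth _ a) => [|i].
  by rewrite size_tuple size_cat hk [size (_ :: _)]/= size_drop size_tuple addnS subnKC.
rewrite size_tuple => hi; rewrite (nth_map ord0) ?size_enum_ord //=.
rewrite nth_cat hk (nth_ord_enum ord0 (Ordinal hi)).
case: unliftP => [j|] /(congr1 val) /= e; last first.
  by rewrite e ltnn subnn.
rewrite {}e /bump (tnth_nth a).
case: (leqP k j) => h; rewrite ?add1n ?add0n.
  by rewrite ltnNge (leqW h) /= subSn //= nth_drop subnKC.
by rewrite h nth_take.
Qed.

Lemma permw_lift n (k : 'I_n.+1) (s : 'S_n) a (w : n.-tuple 'I_d) :
  permw (lift_perm ord0 k s) (instup k (a, w)) = a :: permw s w :> seq _.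
Proof.
rewrite -[RHS]/(val [tuple of a :: permw s w]); congr val.
apply: eq_from_tnth => i; rewrite !tnth_mktuple.
case: (unliftP ord0 i) => [j ->|->].
  by rewrite lift_perm_lift liftK tnthS tnth_mktuple.
by rewrite lift_perm_id unlift_none tnth0.
Qed.

Definition liftp n (p : 'I_n.+1 * 'S_n) : 'S_n.+1 := lift_perm ord0 p.1 p.2.

Lemma liftp_bij n : bijective (@liftp n).
Proof.
apply: inj_card_bij => [[k s] [l t]|]; last first.
  by rewrite card_prod card_ord !card_Sn factS.
rewrite /liftp /= => e; have kl : k = l.
  by rewrite -(lift_perm_id ord0 k s) e lift_perm_id.
rewrite kl in e *; congr pair; apply/permP => i; apply: (@lift_inj _ l).
by rewrite -!(lift_perm_lift ord0) e.
Qed.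

Lemma lcreate_adj n v f g : tensor_dot n.+1 (lcreate v f) g = tensor_dot n f (lannih v g).
Proof.
rewrite /tensor_dot (reindex (@liftp n)); last exact/onW_bij/liftp_bij.
rewrite -(pair_bigA _ (fun k s => (q%:C) ^+ inversions (liftp (k, s)) *
  \sum_(w : n.+1.-tuple 'I_d) lcreate v f (permw (liftp (k, s)) w) * (g w)^*)).
rewrite exchange_big; apply: eq_bigr => s _ /=.
transitivity (\sum_(k < n.+1) q%:C ^+ inversions s * (q%:C ^+ k *
    \sum_(w : n.-tuple 'I_d) \sum_(a < d) f (permw s w) *
       (v 0 a * (g (insertw k a w))^*))).
  apply: eq_bigr => k _; rewrite /liftp inversions_lift exprD -mulrA mulrCA.
  congr (_ * (_ * _)); rewrite (reindex (instup k)); last exact/onW_bij/instup_bij.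
  rewrite -(pair_bigA _ (fun a w => lcreate v f
    (permw (lift_perm ord0 k s) (instup k (a, w))) * (g (instup k (a, w)))^*)).
  rewrite exchange_big; apply: eq_bigr => w _; apply: eq_bigr => a _.
  by rewrite permw_lift instupE /= mulrCA mulrA.
rewrite -[LHS]mulr_sumr; congr (_ * _).
under [LHS]eq_bigr => k _ do rewrite mulr_sumr.
rewrite exchange_big; apply: eq_bigr => w _.
rewrite /lannih rmorph_sum size_tuple. rewrite mulr_sumr.
apply: eq_bigr => k _; rewrite rmorphM rmorphXn rmorph_sum mulrCA.
congr (_ * _); first by congr (_ ^+ _); apply/esym/conjc_real.
rewrite mulr_sumr; apply: eq_bigr => a _.
by rewrite rmorphM /= conjCK.
Qed.

Lemma lannih_lcreate v f :
  lannih v (lcreate v f) = cdot v v *: f + q%:C *: lcreate v (lannih v f).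
Proof.
apply/funext => w; rewrite /lannih [RHS]/GRing.add /=.
have h0 : \sum_(a < d) (v 0 a)^* * lcreate v f (insertw 0 a w) = cdot v v * f w.
  rewrite mulr_suml; apply: eq_bigr => a _.
  by rewrite /insertw take0 drop0 /= mulrA [_^* * _]mulrC.
rewrite big_ord_recl expr0 mul1r h0; congr (_ + _).
case: w {h0} => [|b w] /=; first by rewrite big_ord0 [RHS]mulr0.
transitivity (q%:C * (v 0 b * lannih v f w)) => //.
rewrite /lannih !mulr_sumr; apply: eq_bigr => k _.
rewrite exprS -!mulrA; congr (_ * _); rewrite [RHS]mulrCA; congr (_ * _).
by rewrite mulr_sumr; apply: eq_bigr => a _; rewrite /insertw /= mulrCA.
Qed.

Lemma tensor_dotE n f : tensor_dot n f f = (tensor_norm2 n f)%:C.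
Proof. by apply/esym/RRe_real/ger0_real/tensor_dot_ge0. Qed.

Lemma tensor_norm2_ge0 n f : 0 <= tensor_norm2 n f.
Proof. by rewrite -lecR -tensor_dotE tensor_dot_ge0. Qed.

Lemma cdot_ge0 v : 0 <= cdot v v.
Proof. by apply: sumr_ge0 => i _; rewrite mul_conjC_ge0. Qed.

Lemma tensor_norm2_lcreate0 v f :
  tensor_norm2 1 (lcreate v f) = complex.Re (cdot v v) * tensor_norm2 0 f.
Proof.
apply: (@complexI R); rewrite -tensor_dotE lcreate_adj lannih_lcreate tensor_dotDr !tensor_dotZr.
rewrite rmorphM /= -tensor_dotE RRe_real ?ger0_real ?cdot_ge0 //.
rewrite (CrealP (ger0_real (cdot_ge0 v))).
rewrite [X in _ + _ * X]big1 ?mulr0 ?addr0 // => s _.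
rewrite big1 ?mulr0 // => w _.
by rewrite [w]tuple0 [X in _ * Num.conj X](_ : _ = 0) // conjC0 mulr0.
Qed.

Lemma tensor_norm2_lcreateS n v f :
  tensor_norm2 n.+2 (lcreate v f) =
    complex.Re (cdot v v) * tensor_norm2 n.+1 f + q * tensor_norm2 n (lannih v f).
Proof.
apply: (@complexI R); rewrite -tensor_dotE lcreate_adj lannih_lcreate tensor_dotDr !tensor_dotZr.
rewrite rmorphD !rmorphM /= -!tensor_dotE RRe_real ?ger0_real ?cdot_ge0 //.
rewrite (CrealP (ger0_real (cdot_ge0 v))).
rewrite [tensor_dot n.+1 f (lcreate _ _)]tensor_dotC lcreate_adj -tensor_dotC; congr (_ + _ * _).
exact/conjc_real.
Qed.

Lemma lannih_bound n v f (K : R) : 0 < K ->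
  (forall f, tensor_norm2 n.+1 (lcreate v f) <= K * tensor_norm2 n f) ->
  tensor_norm2 n (lannih v f) <= K * tensor_norm2 n.+1 f.
Proof.
move=> K0 hK; pose h := lcreate v (lannih v f).
have e1 : tensor_dot n.+1 h f = (tensor_norm2 n (lannih v f))%:C by rewrite lcreate_adj tensor_dotE.
have e2 : tensor_dot n.+1 f h = (tensor_norm2 n (lannih v f))%:C.
  by rewrite tensor_dotC e1; apply/conjc_real.
have := tensor_norm2_ge0 n.+1 (K%:C *: f + (-1) *: h).
have -> : tensor_norm2 n.+1 (K%:C *: f + (-1) *: h) =
    K * K * tensor_norm2 n.+1 f - (K * tensor_norm2 n (lannih v f) + K * tensor_norm2 n (lannih v f)) +
    tensor_norm2 n.+1 h.
  apply: (@complexI R); rewrite -tensor_dotE !tensor_dotDl !tensor_dotDr !tensor_dotZl !tensor_dotZr e1 e2 !tensor_dotE.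
  rewrite !rmorphD rmorphN !rmorphM rmorphN rmorph1 /= (conjc_real K : (K%:C)^* = _).
  by ring.
move: (hK (lannih v f)); rewrite -/h => {}hK h0.
suff: K * tensor_norm2 n (lannih v f) <= K * (K * tensor_norm2 n.+1 f) by rewrite ler_pM2l.
lra.
Qed.

Definition lbound (v : 'rV[C]_d) : R := (complex.Re (cdot v v) + 1) / (1 - `|q|).

Lemma lcreate_bound n v f : tensor_norm2 n.+1 (lcreate v f) <= lbound v * tensor_norm2 n f.
Proof.
have q1 : `|q| < 1 by rewrite ltr_norml.
have v0 : 0 <= complex.Re (cdot v v).
  by rewrite -lecR RRe_real ?ger0_real ?cdot_ge0.
have K0 : 0 < lbound v by rewrite divr_gt0 // ?subr_gt0 // ltr_wpDl.
have eK : lbound v * (1 - `|q|) = complex.Re (cdot v v) + 1.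
  by rewrite divfK // gt_eqF // subr_gt0.
have qq : q <= `|q| by exact: ler_norm.
elim: n f => [|n IHn] f.
  rewrite tensor_norm2_lcreate0 ler_wpM2r ?tensor_norm2_ge0 //; have := normr_ge0 q; nra.
have h0 := tensor_norm2_ge0 n.+1 f; have h1 := tensor_norm2_ge0 n (lannih v f).
rewrite tensor_norm2_lcreateS.
have h2 := lannih_bound f K0 IHn.
have h3 : q * tensor_norm2 n (lannih v f) <= `|q| * (lbound v * tensor_norm2 n.+1 f).
  apply: (le_trans (ler_wpM2r h1 qq)); exact: ler_wpM2l.
nra.
Qed.

Definition rcreate (v : 'rV[C]_d) f : coeffs :=
  fun w => (if w is i :: w' then f (belast i w') * v 0 (last i w') else 0) : C.

Definition flip f : coeffs := fun w => f (rev w).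

Lemma rcreateE v f : rcreate v f = flip (lcreate v (flip f)).
Proof.
apply/funext => w; case/lastP: w => [//|w i].
rewrite /flip rev_rcons /= revK mulrC.
by case: w => [|j w] //=; rewrite last_rcons belast_rcons.
Qed.

Lemma rev_permw n (w : n.-tuple 'I_d) : rev w = permw (revp n) w.
Proof.
have sw : size (rev w) == n by rewrite size_rev size_tuple.
rewrite -[LHS]/(val (Tuple sw)); congr val; apply: eq_from_tnth => i.
have x0 := tnth w i.
rewrite (tnth_nth x0) tnth_mktuple (tnth_nth x0) /= nth_rev size_tuple ?ltn_ord //.
by rewrite permE.
Qed.

Lemma revpK n : (revp n * revp n = 1)%g.
Proof. by apply/permP => i; rewrite permM !permE rev_ordK. Qed.

Lemma tensor_dot_flip n f g : tensor_dot n (flip f) (flip g) = tensor_dot n f g.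
Proof.
have hb : bijective (fun s : 'S_n => revp n * s * revp n)%g.
  by exists (fun s : 'S_n => revp n * s * revp n)%g => s;
    rewrite !mulgA revpK mul1g -mulgA revpK mulg1.
rewrite /tensor_dot (reindex _ (onW_bij _ hb)); apply: eq_bigr => s _.
rewrite inversions_rev; congr (_ * _).
rewrite (reindex (permw (revp n))); last exact/onW_bij/permw_bij.
apply: eq_bigr => w _; rewrite /flip !rev_permw !permwM !mulgA revpK mul1g.
by rewrite -mulgA revpK mulg1 permw1.
Qed.

Lemma flipK f : flip (flip f) = f.
Proof. by apply/funext => w; rewrite /flip revK. Qed.

Definition rannih v f := flip (lannih v (flip f)).

Lemma rcreate_adj n v f g : tensor_dot n.+1 (rcreate v f) g = tensor_dot n f (rannih v g).
Proof.
by rewrite rcreateE -[g]flipK tensor_dot_flip lcreate_adj -(tensor_dot_flip n f) /rannih !flipK.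
Qed.

Lemma tensor_norm2_flip n f : tensor_norm2 n (flip f) = tensor_norm2 n f.
Proof. by rewrite /tensor_norm2 tensor_dot_flip. Qed.

Lemma rcreate_bound n v f : tensor_norm2 n.+1 (rcreate v f) <= lbound v * tensor_norm2 n f.
Proof. by rewrite rcreateE -(tensor_norm2_flip n f) tensor_norm2_flip lcreate_bound. Qed.

Lemma lbound_gt0 v : 0 < lbound v.
Proof.
have v0 : 0 <= complex.Re (cdot v v).
  by rewrite -lecR RRe_real ?ger0_real ?cdot_ge0.
by rewrite divr_gt0 // ?subr_gt0 ?ltr_norml // ltr_wpDl.
Qed.

Lemma lannih_le n v f : tensor_norm2 n (lannih v f) <= lbound v * tensor_norm2 n.+1 f.
Proof. exact: lannih_bound (lbound_gt0 v) (lcreate_bound n v). Qed.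

Lemma rannih_le n v f : tensor_norm2 n (rannih v f) <= lbound v * tensor_norm2 n.+1 f.
Proof. by rewrite tensor_norm2_flip -(tensor_norm2_flip n.+1 f) lannih_le. Qed.

Definition square_summable : {pred coeffs} :=
  [pred f | `[< cvgn (series (fun n => tensor_norm2 n f)) >]].

Lemma square_summable_le (f g : coeffs) (K : R) :
  (forall n, tensor_norm2 n f <= K * tensor_norm2 n g) ->
  g \in square_summable -> f \in square_summable.
Proof.
move=> fg /asboolP gc; apply/asboolP.
apply: (series_le_cvg (fun n => tensor_norm2_ge0 n f) _ fg).
  by move=> n; rewrite (le_trans _ (fg n)) ?tensor_norm2_ge0.
exact: is_cvg_seriesZ.
Qed.

Lemma is_cvg_seriesS (u : nat -> R) :
  cvgn (series (fun k => u k.+1)) -> cvgn (series u).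
Proof.
case/cvg_ex => l hl; apply/cvg_ex; exists (u 0%N + l).
rewrite -(cvg_shiftS (series u)).
have -> : [sequence series u n.+1]_n = (fun=> u 0%N) \+ series (fun k => u k.+1).
  by apply/funext => n; rewrite /series /= big_nat_recl.
by apply: cvgD => //; exact: cvg_cst.
Qed.

Lemma square_summable_shift (A : coeffs -> coeffs) (K : R) f :
  (forall n, tensor_norm2 n.+1 (A f) <= K * tensor_norm2 n f) ->
  f \in square_summable -> A f \in square_summable.
Proof.
move=> fg /asboolP gc; apply/asboolP/is_cvg_seriesS.
apply: (series_le_cvg (fun n => tensor_norm2_ge0 n.+1 _) _ fg).
  by move=> n; rewrite (le_trans _ (fg n)) ?tensor_norm2_ge0.
exact: is_cvg_seriesZ.
Qed.

Lemma square_summable_finite f N :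
  (forall w, (N <= size w)%N -> f w = 0) -> f \in square_summable.
Proof.
move=> f0; apply/asboolP; rewrite -(is_cvg_series_restrict N).
rewrite (_ : (fun n => _) = fun=> 0); first exact: is_cvg_cst.
apply/funext => n; rewrite big_nat_cond big1 // => k /andP[/andP[Nk _] _].
have -> : tensor_norm2 k f = tensor_norm2 k (0 *: f).
  by congr complex.Re; apply: eq_tensor_dot => w wk; rewrite f0 ?wk // [RHS]mul0r.
by rewrite /tensor_norm2 tensor_dotZl mul0r.
Qed.

Lemma tensor_norm2D n f g : tensor_norm2 n (f + g) <= 2 * (tensor_norm2 n f + tensor_norm2 n g).
Proof.
have := tensor_norm2_ge0 n (f + (-1) *: g); rewrite /tensor_norm2.
rewrite !tensor_dotDl !tensor_dotDr !tensor_dotZl !tensor_dotZr !raddfD /= rmorphN rmorph1 !mulN1r opprK.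
rewrite !raddfN /=; lra.
Qed.

Lemma tensor_norm2Z n a f : tensor_norm2 n (a *: f) = (complex.Re (a * a^*)) * tensor_norm2 n f.
Proof.
apply: (@complexI R); rewrite -tensor_dotE tensor_dotZl tensor_dotZr rmorphM /= -tensor_dotE mulrA.
by rewrite RRe_real // ger0_real // mul_conjC_ge0.
Qed.

Lemma square_summable_closed : submod_closed square_summable.
Proof.
split=> [|a f g hf /asboolP hg]; first exact: (@square_summable_finite _ 0).
have /asboolP haf : a *: f \in square_summable.
  by apply: square_summable_le hf => n; rewrite tensor_norm2Z.
apply/asboolP; apply: (series_le_cvg (fun n => tensor_norm2_ge0 n _) _ (fun n => tensor_norm2D n _ _)).
  by move=> n; rewrite mulr_ge0 // addr_ge0 ?tensor_norm2_ge0.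
exact/is_cvg_seriesZ/is_cvg_seriesD.
Qed.

Lemma limn_shiftS (u : nat -> R) : limn (fun n => u n.+1) = limn u.
Proof.
rewrite /lim /lim_in; congr (get _); apply/funext => l.
exact: cvg_shiftS.
Qed.
End Algebra.

(* The Hilbert space direct sum: families with summable squared q-norms. *)
Record fock (R : realType) (d : nat) (q : R) (hq : -1 < q < 1) := Fock {
  coef :> seq 'I_d -> (R[i])^o;
  _ : coef \in square_summable q }.
Arguments Fock {R d q} hq.

Section FockSpace.
Variables (R : realType) (d : nat) (q : R) (hq : -1 < q < 1).
Local Notation C := R[i].

HB.instance Definition _ :=
  GRing.isSubmodClosed.Build C (seq 'I_d -> C^o) (@square_summable R d q)
    (square_summable_closed d hq).
HB.instance Definition _ := [isSub for @coef R d q hq].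
HB.instance Definition _ := [Choice of fock d hq by <:].
HB.instance Definition _ := [SubChoice_isSubLmodule of fock d hq by <:].

(* R[i] carries no topology in the library, so the series of the inner products of
   the components is summed on real and imaginary parts. *)
Definition fock_dot (x y : fock d hq) : C :=
  limn (series (fun n => complex.Re (tensor_dot q n x y))) +i*
  limn (series (fun n => complex.Im (tensor_dot q n x y))).

Lemma vac_summable :
  (fun w : seq 'I_d => (w == [::])%:R : C^o) \in square_summable q.
Proof. by apply: (@square_summable_finite _ _ _ _ 1) => -[]. Qed.

Definition vac : fock d hq := Fock hq _ vac_summable.

Definition left_creation (v : 'rV[C]_d) (x : fock d hq) : fock d hq :=
  Fock hq (lcreate v x)
    (square_summable_shift hq (fun n => lcreate_bound hq n v x) (valP x)).

Definition right_creation (v : 'rV[C]_d) (x : fock d hq) : fock d hq :=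
  Fock hq (rcreate v x)
    (square_summable_shift hq (fun n => rcreate_bound hq n v x) (valP x)).

(* [adjoint A y] is the vector z such that <A x, y> = <x, z> for all x; that it
   exists for the creation operators is [left_creation_adjoint] and
   [right_creation_adjoint]. *)
Definition adjoint (A : fock d hq -> fock d hq) (y : fock d hq) : fock d hq :=
  xget 0 [set z | forall x, fock_dot (A x) y = fock_dot x z].

Lemma fock_dot_shift (A : fock d hq -> fock d hq) (x y z : fock d hq) :
  tensor_dot q 0 (A x) y = 0 ->
  (forall n, tensor_dot q n.+1 (A x) y = tensor_dot q n x z) ->
  fock_dot (A x) y = fock_dot x z.
Proof.
move=> h0 hS; rewrite /fock_dot -(limn_shiftS (series (fun n => complex.Re _))).
rewrite -(limn_shiftS (series (fun n => complex.Im _))).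
congr (limn _ +i* limn _); apply/funext => n; rewrite /series /= big_nat_recl //.
  by rewrite h0 add0r; apply: eq_bigr => k _; rewrite hS.
by rewrite h0 add0r; apply: eq_bigr => k _; rewrite hS.
Qed.

Lemma adjoint_shift (A : fock d hq -> fock d hq)
    (B : (seq 'I_d -> C^o) -> (seq 'I_d -> C^o)) (K : R) (y : fock d hq) :
  (forall x, (A x : seq 'I_d -> C) [::] = 0) ->
  (forall n x, tensor_dot q n.+1 (A x) y = tensor_dot q n x (B y)) ->
  (forall n, tensor_norm2 q n (B y) <= K * tensor_norm2 q n.+1 y) ->
  forall x, fock_dot (A x) y = fock_dot x (adjoint A y).
Proof.
move=> A0 AB hB.
have By : B y \in square_summable q.
  have /asboolP yc := valP y; apply/asboolP.
  apply: (series_le_cvg (fun n => tensor_norm2_ge0 hq n _) _ hB).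
    by move=> n; rewrite (le_trans _ (hB n)) ?(tensor_norm2_ge0 hq).
  apply/is_cvg_seriesZ; case/cvg_ex: yc => l hl; apply/cvg_ex.
  exists (l - tensor_norm2 q 0 y); move: hl; rewrite -(cvg_shiftS (series _)) => hl.
  have -> : series (fun n => tensor_norm2 q n.+1 y) =
      [sequence series (fun n => tensor_norm2 q n y) n.+1]_n \- (fun=> tensor_norm2 q 0 y).
    apply/funext => n; rewrite /series /= big_nat_recl //.
    by rewrite [RHS]addrAC subrr add0r.
  by apply: cvgB => //; exact: cvg_cst.
apply: (@xgetPex _ 0 [set z | forall x, fock_dot (A x) y = fock_dot x z]).
exists (Fock hq _ By) => x /=; apply: fock_dot_shift => [|n]; last exact: AB.
rewrite /tensor_dot big1 // => s _; rewrite big1 ?mulr0 // => w _.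
by rewrite [permw s w]tuple0 A0 mul0r.
Qed.

Lemma left_creation_adjoint v (x y : fock d hq) : fock_dot (left_creation v x) y = fock_dot x (adjoint (left_creation v) y).
Proof.
by apply: (@adjoint_shift _ (lannih q v) (lbound q v)) => // *;
  rewrite ?lcreate_adj // lannih_le.
Qed.

Lemma right_creation_adjoint v (x y : fock d hq) : fock_dot (right_creation v x) y = fock_dot x (adjoint (right_creation v) y).
Proof.
by apply: (@adjoint_shift _ (rannih q v) (lbound q v)) => // *;
  rewrite ?rcreate_adj // rannih_le.
Qed.

End FockSpace.

Lemma prodr_sumE (A : comNzRingType) (I J : finType) (F : I -> J -> A) :
  \prod_i \sum_j F i j = \sum_(f : {ffun I -> J}) \prod_i F i (f i).
Proof. exact: bigA_distr_bigA. Qed.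

Section Tensors.
Variables (R : realType) (d : nat) (q : R).
Local Notation C := R[i].

(* The elementary tensor of the vectors in [vs]. *)
Definition tensor (vs : seq 'rV[C]_d) : seq 'I_d -> C^o := fun w =>
  (if size w == size vs then \prod_(p <- zip vs w) p.1 0 p.2 else 0) : C.

Lemma tensor_nil w : tensor [::] w = (w == [::])%:R.
Proof. by case: w => [|i w]; rewrite /tensor //= big_nil. Qed.

Lemma lcreate_tensor v vs : lcreate v (tensor vs) = tensor (v :: vs).
Proof.
apply/funext => -[|i w] //=; rewrite /tensor /= eqSS big_cons.
by case: ifP => _ //; rewrite mulr0.
Qed.

Lemma rcreate_tensor v vs : rcreate v (tensor vs) = tensor (rcons vs v).
Proof.
apply/funext => w; case/lastP: w => [|w i].
  by rewrite /tensor size_rcons.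
have -> : rcreate v (tensor vs) (rcons w i) = tensor vs w * v 0 i.
  by case: w => [|j w] //=; rewrite last_rcons belast_rcons.
rewrite /tensor !size_rcons eqSS; case: ifP => [/eqP e|_]; last by rewrite mul0r.
by rewrite zip_rcons // big_rcons.
Qed.

Lemma tensor_dot_tensor n (vs ws : n.-tuple 'rV[C]_d) :
  tensor_dot q n (tensor vs) (tensor ws) =
  \sum_(s : 'S_n) (q%:C) ^+ inversions s *
    \prod_(i < n) cdot (tnth vs i) (tnth ws (s i)).
Proof.
have tensorE (us : n.-tuple 'rV[C]_d) (w : n.-tuple 'I_d) :
    tensor us w = \prod_(i < n) tnth us i 0 (tnth w i).
  rewrite /tensor !size_tuple eqxx.
  rewrite (_ : zip us w = [tuple of zip us w]) // big_tuple.
  apply: eq_bigr => i _; rewrite (tnth_nth (tnth us i, tnth w i)) /=.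
  by rewrite nth_zip ?size_tuple //= -!tnth_nth.
apply: eq_bigr => s _; congr (_ * _); rewrite prodr_sumE.
pose h (w : n.-tuple 'I_d) := [ffun i => tnth w (s i)].
have hb : bijective h.
  exists (fun g : {ffun 'I_n -> 'I_d} => [tuple g (s^-1%g i) | i < n]) => w.
    by apply: eq_from_tnth => i; rewrite tnth_mktuple ffunE permKV.
  by apply/ffunP => i; rewrite ffunE tnth_mktuple permK.
rewrite [RHS](reindex _ (onW_bij _ hb)); apply: eq_bigr => w _.
rewrite !tensorE rmorph_prod [X in _ * X](reindex_inj (@perm_inj _ s)).
by rewrite -big_split; apply: eq_bigr => i _ /=; rewrite tnth_mktuple ffunE.
Qed.
End Tensors.

Section PairPartitions.
Variable m : nat.
Implicit Types (V W : {set 'I_m}) (pi : {set {set 'I_m}}).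

Definition is_pair_partition pi : bool :=
  finset.partition pi [set: 'I_m] && [forall V in pi, #|V| == 2].

Definition crossing V W : bool :=
  [exists a : 'I_m, exists b : 'I_m, exists c : 'I_m, exists e : 'I_m,
    [&& (a < b)%N, (b < c)%N, (c < e)%N &
        ((V == [set a; c]) && (W == [set b; e])) ||
        ((W == [set a; c]) && (V == [set b; e]))]].

Definition crossings pi : nat :=
  #|[set P : {set {set 'I_m}} |
      [exists V in pi, exists W in pi, (P == [set V; W]) && crossing V W]]|.

Definition perm_partition (s : 'S_m) pi : {set {set 'I_m}} :=
  [set s @: V | V : {set 'I_m} in pi].

End PairPartitions.

(* Positions 1, ..., 2n are coded by 'I_(n.*2), i.e. shifted by one: k <= n goes
   to 2k - 1 becomes k |-> 2k for k < n, and k |-> 2(2n + 1 - k) becomes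
   k |-> 2(2n - k) - 1. *)
Definition shuffle_nat n k : nat := if (k < n)%N then k.*2 else ((n.*2 - k).*2).-1.

Lemma shuffle_lt n (k : 'I_(n.*2)) : (shuffle_nat n k < n.*2)%N.
Proof. by rewrite /shuffle_nat; have := ltn_ord k; case: ifP; lia. Qed.

Definition shuffle_fun n (k : 'I_(n.*2)) : 'I_(n.*2) := Ordinal (shuffle_lt k).

Lemma shuffle_inj n : injective (@shuffle_fun n).
Proof.
move=> i j /(congr1 val) /=; rewrite /shuffle_nat => e; apply: val_inj => /=.
by have := ltn_ord i; have := ltn_ord j; move: e; do 2 case: ifP; lia.
Qed.

Definition shuffle n : 'S_(n.*2) := perm (@shuffle_inj n).

(* The symbols 1 and * are coded by [true] and [false]. *)
Definition dyck m (eps : {ffun 'I_m -> bool}) : bool :=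
  [forall h : 'I_m, #|[set i : 'I_m | (i <= h)%N && ~~ eps i]| <=
                    #|[set i : 'I_m | (i <= h)%N && eps i]|]%N &&
  (#|[set i | eps i]| == #|[set i | ~~ eps i]|).

(* Blocks have two elements, so [false] is the value at the maximum of a block. *)
Definition Phi n (pi : {set {set 'I_(n.*2)}}) : {ffun 'I_(n.*2) -> bool} :=
  [ffun i => [exists W in perm_partition (shuffle n) pi,
     (i \in W) && [forall j in W, (i <= j)%N]]].

Section AlternatingWord.
Variables (R : realType) (d : nat) (q : R) (hq : -1 < q < 1) (n : nat).
Variables (eps : {ffun 'I_(n.*2) -> bool}) (u : 'I_(n.*2) -> 'rV[R[i]]_d).

(* After the shift by one, left operators sit at the even positions. *)
Definition letter (i : 'I_(n.*2)) : fock d hq -> fock d hq :=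
  let A := if odd i then right_creation (u i) else left_creation (u i) in
  if eps i then A else adjoint A.

(* The composition letter (2n - 1) \o ... \o letter 1 \o letter 0. *)
Definition alternating_word : fock d hq -> fock d hq :=
  foldl (fun A i => letter i \o A) id (enum 'I_(n.*2)).

End AlternatingWord.

(* Main.v *)
(* Since the q-inner product is definite for |q| < 1, the adjoint creation operators
   act on elementary tensors by the usual formula: the letter on the left removes a
   tensor factor with weight q to the number of factors standing to its left, and
   symmetrically on the right. Reading the word letter by letter, the annihilation
   at time t picks a pending creation x, and the factors passed over are exactly
   the pending letters whose pairs cross {x, t} once positions are unshuffled: left
   letters fill the line from its left end, right letters from its right end. Hence
   the vacuum coefficient obeys the recursion of the sum over pairings obtained by
   removing the pair of the first remaining annihilation. *)
Require Import Defs.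
From HB Require Import structures.
From mathcomp Require Import all_boot all_order all_fingroup all_algebra.
From mathcomp Require Import complex.
From mathcomp Require Import zify ring.
From mathcomp Require Import boolp functions reals topology normedtype sequences.
Set Implicit Arguments.
Unset Strict Implicit.
Unset Printing Implicit Defensive.
Import Order.TTheory GRing.Theory Num.Theory numFieldNormedType.Exports.
Local Open Scope complex_scope.
Local Open Scope ring_scope.

(** * Definiteness of the q-inner product *)

(** Without inversions a permutation is increasing, hence lies above the identity; so does its
    inverse, which has equally many inversions. *)
Lemma inversions_eq0 n (s : 'S_n) : inversions s = 0%N -> s = 1%g.
Proof.
have ge (t : 'S_n) : inversions t = 0%N -> forall i : 'I_n, (i <= t i)%N.
  move=> /eqP; rewrite cards_eq0 => /eqP t0.
  have mono (i j : 'I_n) : (i < j)%N -> (t i < t j)%N.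
    move=> ij; rewrite ltn_neqAle; apply/andP; split.
      by rewrite (inj_eq val_inj) (inj_eq perm_inj) -(inj_eq val_inj) ltn_eqF.
    rewrite leqNgt; apply/negP => ts.
    by have := in_set0 (i, j); rewrite -t0 inE /= ij ts.
  case; elim=> [//|i IH] hi /=.
  exact: leq_ltn_trans (IH (ltnW hi)) (mono (Ordinal (ltnW hi)) (Ordinal hi) (leqnn _)).
move=> s0; apply/permP => i; rewrite perm1; apply: val_inj; apply/eqP.
rewrite eqn_leq ge // andbT.
by have := ge _ (etrans (inversionsV s) s0) (s i); rewrite permK.
Qed.

Section Definite.
Variables (R : realType) (d : nat).
Local Notation C := R[i].
Implicit Types (f g : seq 'I_d -> C^o).

(* Averaging over the symmetric group turns the q-norm into a sum of squares
   whose dependence on q is only through the weights, positive for |q| < 1. *)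
Lemma tensor_dot_squares n f :
  exists2 X : {set 'I_n * 'I_n} -> C, forall J, 0 <= X J &
  forall q : R, tensor_dot q n f f *+ n`! =
    \sum_(J : {set 'I_n * 'I_n})
      (\prod_(p : 'I_n * 'I_n) if p \in J then (1 - q%:C) / 2 else (1 + q%:C) / 2) * X J.
Proof.
(* By [kernelE] these signs split the kernel at [r * s^-1] into a factor in [r] and one in [s]. *)
pose chi (J : {set 'I_n * 'I_n}) (r : 'S_n) : C := \prod_(p in J) (-1) ^+ asc r p.1 p.2.
have chiJ J r : (chi J r)^* = chi J r.
  by rewrite /chi rmorph_prod /=; apply: eq_bigr => p _; rewrite rmorphXn rmorphN1.
exists (fun J => \sum_(w : n.-tuple 'I_d)
  (\sum_r chi J r * f (permw r w)) * (\sum_r chi J r * f (permw r w))^*) => [J|q].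
  by apply: sumr_ge0 => w _; rewrite mul_conjC_ge0.
transitivity (\sum_(s : 'S_n) \sum_(r : 'S_n) \sum_(w : n.-tuple 'I_d)
    (q%:C) ^+ inversions (r * s^-1)%g * (f (permw r w) * (f (permw s w))^*)).
  (* The [n!] copies are spread over all [s], and the [s]-th copy is reindexed by [s^-1] to bring
     out the kernel in [r] and [s]. *)
  rewrite -card_Sn -sumr_const; apply: eq_big => [s|s _]; first by rewrite inE.
  rewrite /tensor_dot (reindex_inj (@mulIg _ s^-1%g)); apply: eq_bigr => r _.
  rewrite (reindex (permw s)); last exact/onW_bij/permw_bij.
  by rewrite mulr_sumr; apply: eq_bigr => w _; rewrite permwM mulgKV.
rewrite exchange_big /= (eq_bigr _ (fun r _ => exchange_big _ _ _ _ _ _)) exchange_big /=.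
under [RHS]eq_bigr => J _ do rewrite mulr_sumr.
rewrite [RHS]exchange_big; apply: eq_bigr => w _ /=.
under [RHS]eq_bigr => J _ do rewrite rmorph_sum big_distrlr /= mulr_sumr.
rewrite [RHS]exchange_big; apply: eq_bigr => r _ /=.
under [RHS]eq_bigr => J _ do rewrite mulr_sumr.
rewrite [RHS]exchange_big; apply: eq_bigr => s _ /=.
rewrite kernelE mulr_suml; apply: eq_bigr => J _.
by rewrite rmorphM /= chiJ -/(chi J r) -/(chi J s); ring.
Qed.

(** As [0 ^+ 0 = 1], only the identity contributes at [q = 0], which leaves the standard form. *)
Lemma tensor_dot0 n f : tensor_dot 0 n f f = \sum_(w : n.-tuple 'I_d) f w * (f w)^*.
Proof.
rewrite /tensor_dot (bigD1 1%g) // -[RHS]addr0; congr (_ + _).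
  have -> : inversions (1%g : 'S_n) = 0%N.
    by apply: double_inj; rewrite double_inversions big1 // => i _;
      rewrite big1 // => j _; rewrite !perm1 addbb.
  by rewrite expr0 mul1r; apply: eq_bigr => w _; rewrite permw1.
apply: big1 => s /= s1; rewrite expr0n; case: eqP => [/inversions_eq0 e|]; last by rewrite mul0r.
by rewrite e eqxx in s1.
Qed.

(** A vanishing q-norm kills every square, as all weights are positive. The squares do not depend on
    [q], so the norm at [q = 0] vanishes too, and that one is the standard norm. *)
Lemma tensor_dot_definite (q : R) n f : -1 < q < 1 -> tensor_dot q n f f = 0 ->
  forall w, size w = n -> f w = 0.
Proof.
move=> /andP[q1 q2] f0 w wn.
have [X X0 hX] := tensor_dot_squares n f.
have c0 J : 0 < (\prod_(p : 'I_n * 'I_n)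
    if p \in J then (1 - q%:C) / 2 else (1 + q%:C) / 2 : C).
  apply: prodr_gt0 => p _; case: ifP => _; rewrite divr_gt0 // -[1]/(1%:C).
    by rewrite -rmorphB /= ltcR subr_gt0.
  by rewrite -rmorphD /= ltcR -ltrBlDl sub0r.
have XJ J : X J = 0.
  move/esym/eqP: (hX q); rewrite f0 mul0rn psumr_eq0; last first.
    by move=> K _; rewrite mulr_ge0 // ltW.
  move=> /allP/(_ J); rewrite mem_index_enum => /(_ isT).
  by rewrite mulf_eq0 gt_eqF ?c0 //= => /eqP.
move/eqP: (hX 0); rewrite big1 => [|J _]; last by rewrite XJ mulr0.
rewrite -mulr_natr mulf_eq0 pnatr_eq0 gtn_eqF ?fact_gt0 // orbF tensor_dot0.
rewrite psumr_eq0 => [|? _]; last exact: mul_conjC_ge0.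
move: wn => /eqP wn /allP/(_ (Tuple wn)); rewrite mem_index_enum => /(_ isT) /=.
by rewrite mul_conjC_eq0 => /eqP.
Qed.

Lemma tensor_dot_separates (q : R) n g g' : -1 < q < 1 ->
  (forall f, (forall w, size w != n -> f w = 0) ->
     tensor_dot q n f g = tensor_dot q n f g') ->
  forall w, size w = n -> g w = g' w.
Proof.
move=> hq h w wn.
(* The test vector is the difference cut off to degree [n], as only homogeneous test vectors are
   available. *)
pose f : seq 'I_d -> C^o := fun v => if size v == n then g v - g' v else 0.
have ef v : size v = n -> f v = (g + (-1) *: g') v.
  by rewrite /f => ->; rewrite eqxx scaleN1r.
have /(_ w wn) : forall w, size w = n -> f w = 0.
  apply: (tensor_dot_definite hq).
  rewrite (eq_tensor_dot q (g' := g + (-1) *: g') (f' := f)) //.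
  rewrite tensor_dotDr tensor_dotZr h => [|v vn]; last by rewrite /f (negbTE vn).
  by rewrite rmorphN1 mulN1r subrr.
by rewrite /f wn eqxx => /eqP; rewrite subr_eq0 => /eqP.
Qed.

End Definite.

(** * The Hilbert space adjoints are the formal annihilation operators *)

Section Adjoints.
Variables (R : realType) (d : nat) (q : R) (hq : -1 < q < 1).
Local Notation C := R[i].

Lemma limn_series_single (a : nat -> R) n :
  (forall k, k != n -> a k = 0) -> limn (series a) = a n.
Proof.
move=> a0; apply/cvg_lim => //; apply: cvg_near_cst; exists n.+1 => // k /= nk.
rewrite /series /= (big_cat_nat (n := n)) //=; last exact: ltnW.
rewrite big_nat_cond big1 ?add0r; last first.
  by move=> i /andP[/andP[_ ik] _]; rewrite a0 // ltn_eqF.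
rewrite big_ltn // big_nat_cond big1 ?addr0 // => i /andP[/andP[ni _] _].
by rewrite a0 // gtn_eqF.
Qed.

Lemma fock_dot_homogeneous n (x y : fock d hq) :
  (forall w, size w != n -> coef x w = 0) -> fock_dot x y = tensor_dot q n x y.
Proof.
move=> x0; have t0 k : k != n -> tensor_dot q k x y = 0.
  move=> kn; rewrite /tensor_dot big1 // => s _; rewrite big1 ?mulr0 // => w _.
  by rewrite x0 ?mul0r // size_tuple.
rewrite /fock_dot !(@limn_series_single _ n); first by case: (tensor_dot q n x y).
  by move=> k /t0 ->.
by move=> k /t0 ->.
Qed.

(* The two adjoints agree because finitely supported vectors separate points. *)
Lemma adjoint_coef (A : fock d hq -> fock d hq)
    (Ac B : (seq 'I_d -> C^o) -> (seq 'I_d -> C^o)) (y : fock d hq) :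
  (forall x, coef (A x) = Ac (coef x)) ->
  (forall n f, (forall w, size w != n -> f w = 0) ->
     forall w, size w != n.+1 -> Ac f w = 0) ->
  (forall n f g, tensor_dot q n.+1 (Ac f) g = tensor_dot q n f (B g)) ->
  (forall x, fock_dot (A x) y = fock_dot x (adjoint A y)) ->
  coef (adjoint A y) = B y.
Proof.
move=> Acoef Adeg AB adj; apply/funext => w; set n := size w.
apply: (tensor_dot_separates hq (n := n)) => // f f0.
have fs : f \in square_summable q.
  apply: (@square_summable_finite _ _ _ _ n.+1) => v vn.
  by apply: f0; rewrite gtn_eqF.
have := adj (Fock hq f fs).
rewrite (@fock_dot_homogeneous n.+1 (A _)) ?Acoef; last exact: Adeg.
by rewrite (@fock_dot_homogeneous n (Fock _ _ _)) // AB.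
Qed.

Lemma coef_adjoint_left v (y : fock d hq) :
  coef (adjoint (left_creation v) y) = lannih q v y.
Proof.
apply: (@adjoint_coef _ (lcreate v)) => //.
- move=> n f f0 [|i w] //=; rewrite eqSS => wn.
  by rewrite f0 // mulr0.
- by move=> *; rewrite lcreate_adj.
- by move=> x; rewrite left_creation_adjoint.
Qed.

Lemma coef_adjoint_right v (y : fock d hq) :
  coef (adjoint (right_creation v) y) = rannih q v y.
Proof.
apply: (@adjoint_coef _ (rcreate v)) => //.
- move=> n f f0 [|i w] //=; rewrite eqSS => wn.
  by rewrite f0 ?mul0r // size_belast.
- by move=> *; rewrite rcreate_adj.
- by move=> x; rewrite right_creation_adjoint.
Qed.

End Adjoints.

(** * Annihilation operators on elementary tensors *)

Lemma pairwise_rev (T : Type) (r : rel T) (s : seq T) :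
  pairwise r (rev s) = pairwise (fun x y => r y x) s.
Proof. by elim: s => //= x s IH; rewrite rev_cons pairwise_rcons all_rev IH. Qed.

Section Annihilation.
Variables (R : realType) (d : nat) (q : R).
Local Notation C := R[i].
Implicit Types (f g : seq 'I_d -> C^o) (v : 'rV[C]_d).

(** The q-commutation relation. Inserting in front pairs the new letter with [v']; every later
    insertion first passes the leading letter, which costs one factor [q]. *)
Lemma lannih_lcreate2 v v' f :
  lannih q v (lcreate v' f) = cdot v' v *: f + q%:C *: lcreate v' (lannih q v f).
Proof.
apply/funext => w; rewrite !addrfctE !scalrfctE /lannih big_ord_recl expr0 mul1r; congr (_ + _).
  rewrite [RHS]mulr_suml; apply: eq_bigr => a _.
  by rewrite /insertw take0 drop0 /= mulrA [_^* * _]mulrC.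
case: w => [|b w] /=; first by rewrite big_ord0 [RHS]mulr0.
transitivity (q%:C * (v' 0 b * lannih q v f w)) => //.
rewrite /lannih !mulr_sumr; apply: eq_bigr => k _.
rewrite exprS -!mulrA; congr (_ * _); rewrite [RHS]mulrCA; congr (_ * _).
by rewrite mulr_sumr; apply: eq_bigr => a _; rewrite /insertw /= mulrCA.
Qed.

Lemma lannih_tensor_nil v : lannih q v (tensor [::]) = 0.
Proof.
apply/funext => w; rewrite /lannih big1 // => k _; rewrite big1 ?mulr0 // => a _.
rewrite tensor_nil; case: eqP; rewrite ?mulr0 // => /(congr1 size).
by rewrite /insertw size_cat /= addnS.
Qed.

Lemma lcreateD v f g : lcreate v (f + g) = lcreate v f + lcreate v g.
Proof. by apply/funext => -[|i w]; rewrite !addrfctE /= ?addr0 //; exact: mulrDr. Qed.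

Lemma lcreateZ v a f : lcreate v (a *: f) = a *: lcreate v f.
Proof. by apply/funext => -[|i w]; rewrite !scalrfctE /= ?scaler0 //; exact: mulrCA. Qed.

Lemma lannihD v f g : lannih q v (f + g) = lannih q v f + lannih q v g.
Proof.
apply/funext => w; rewrite !addrfctE /lannih -big_split; apply: eq_bigr => k _ /=.
rewrite -mulrDr -big_split; congr (_ * _); apply: eq_bigr => a _ /=.
by rewrite -mulrDr.
Qed.

Lemma lannihZ v a f : lannih q v (a *: f) = a *: lannih q v f.
Proof.
apply/funext => w; rewrite !scalrfctE /lannih [RHS]mulr_sumr; apply: eq_bigr => k _.
rewrite [RHS]mulrCA; congr (_ * _); rewrite [RHS]mulr_sumr; apply: eq_bigr => b _.
exact: mulrCA.
Qed.

Lemma flipD f g : flip (f + g) = flip f + flip g. Proof. by []. Qed.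

Lemma flipZ (a : C) f : flip (a *: f) = a *: flip f. Proof. by []. Qed.

Lemma flip_tensor (vs : seq 'rV[C]_d) : flip (tensor vs) = tensor (rev vs).
Proof.
elim: vs => [|v vs IH].
  apply/funext => w; rewrite /flip !tensor_nil.
  by rewrite -!size_eq0 size_rev.
by rewrite -lcreate_tensor rev_cons -rcreate_tensor -IH rcreateE flipK.
Qed.

(* [lt] is the left-to-right order of the tensor factors. *)
Lemma lannih_tensor (T : eqType) (lt : rel T) (u : T -> 'rV[C]_d) v (s : seq T) :
  irreflexive lt -> antisymmetric lt -> pairwise lt s ->
  lannih q v (tensor (map u s)) =
  \sum_(x <- s) ((q%:C ^+ count (lt^~ x) s * cdot (u x) v) *:
    tensor (map u [seq y <- s | y != x])).
Proof.
move=> ltI ltA; elim: s => [|y s IH] /=; first by rewrite lannih_tensor_nil big_nil.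
case/andP=> ys ss; rewrite -lcreate_tensor lannih_lcreate2 big_cons ltI eqxx /=.
have nys : all (predC1 y) s.
  by apply: sub_all ys => z /=; apply: contraTneq => ->; rewrite ltI.
(* The first summand is the term of the head [y]; the second gives, by induction, the other terms,
   with one more [q] because [y] stands to the left of them all. *)
congr (_ + _).
  have -> : count (lt^~ y) s = 0%N.
    apply/eqP; rewrite -leqn0 leqNgt -has_count -all_predC.
    apply/allP => z zs /=; apply/negP => zy; have yz := allP ys _ zs.
    by have := ltA z y; rewrite zy yz => /(_ isT) e; rewrite e ltI in zy.
  by rewrite expr0 mul1r (all_filterP nys).
rewrite IH // (big_morph _ (lcreateD (u y)) (_ : lcreate (u y) 0 = 0)); last first.
  by rewrite -(scale0r (0 : seq 'I_d -> C^o)) lcreateZ !scale0r.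
rewrite scaler_sumr; apply: eq_big_seq => x xs.
rewrite lcreateZ lcreate_tensor scalerA mulrA -exprS (allP ys) //.
by have /= := allP nys _ xs; rewrite eq_sym => ->.
Qed.

(** Conjugation by [flip] reverses the order of the factors, so the exponent counts those to the
    right of [x]. *)
Lemma rannih_tensor (T : eqType) (lt : rel T) (u : T -> 'rV[C]_d) v (s : seq T) :
  irreflexive lt -> antisymmetric lt -> pairwise lt s ->
  rannih q v (tensor (map u s)) =
  \sum_(x <- s) ((q%:C ^+ count (lt x) s * cdot (u x) v) *:
    tensor (map u [seq y <- s | y != x])).
Proof.
move=> ltI ltA ss; rewrite /rannih flip_tensor -map_rev.
rewrite (@lannih_tensor _ (fun x y => lt y x)); last 3 first.
- by move=> x; apply: ltI.
- by move=> x y; rewrite andbC => /ltA.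
- by rewrite pairwise_rev; apply: sub_pairwise ss.
rewrite (big_morph _ flipD (_ : flip 0 = 0)) //.
rewrite (perm_big s) ?perm_rev //=; apply: eq_bigr => x _.
by rewrite flipZ flip_tensor -map_rev filter_rev revK count_rev.
Qed.

End Annihilation.

(** * Crossings of blocks *)

Section Crossings.
Variable m : nat.
Implicit Types (V : {set 'I_m}) (pi : {set {set 'I_m}}).

Lemma set2_lt_inj (a b c e : 'I_m) : (a < b)%N -> (c < e)%N ->
  [set a; b] = [set c; e] -> a = c /\ b = e.
Proof.
move=> ab ce /setP eq.
have := eq a; have := eq b; have := eq c; rewrite !inE !eqxx /= orbT.
by do !case: eqP => [?|_] //=; subst; lia.
Qed.

Lemma crossing_lt (a b c e : 'I_m) : (a < b)%N -> (c < e)%N ->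
  crossing [set a; b] [set c; e] =
    ((a < c < b) && (b < e) || (c < a < e) && (e < b))%N.
Proof.
move=> ab ce; apply/idP/idP.
  case/existsP => a1 /existsP[b1] /existsP[c1] /existsP[e1] /and4P[h1 h2 h3].
  have ac1 := ltn_trans h1 h2; have be1 := ltn_trans h2 h3.
  by case/orP => /andP[/eqP/set2_lt_inj[]// -> -> /eqP/set2_lt_inj[]// -> ->];
    rewrite h1 h2 h3 ?orbT.
move=> h; apply/existsP; case/orP: h => /andP[/andP[h1 h2] h3].
  exists a; apply/existsP; exists c; apply/existsP; exists b; apply/existsP; exists e.
  by rewrite h1 h2 h3 !eqxx.
exists c; apply/existsP; exists a; apply/existsP; exists e; apply/existsP; exists b.
by rewrite h1 h2 h3 !eqxx orbT.
Qed.

(** The first two comparisons differ when [c] lies between [a] and [b], the last two when [e] does;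
    the blocks cross when exactly one of these happens. This form is insensitive to the order within
    a block. *)
Lemma crossing_set2 (a b c e : 'I_m) : uniq [:: a; b; c; e] ->
  crossing [set a; b] [set c; e] = (a < c)%N (+) (b < c)%N (+) (a < e)%N (+) (b < e)%N.
Proof.
rewrite /= !inE !negb_or -!(inj_eq val_inj) /= => h.
case: (ltngtP a b) => [ab|ab|ab]; last by lia.
  case: (ltngtP c e) => [ce|ce|ce]; last by lia.
    by rewrite crossing_lt //; lia.
  by rewrite [[set c; e]]setUC crossing_lt //; lia.
rewrite [[set a; b]]setUC; case: (ltngtP c e) => [ce|ce|ce]; last by lia.
  by rewrite crossing_lt //; lia.
by rewrite [[set c; e]]setUC crossing_lt //; lia.
Qed.

Lemma crossingC V V' : crossing V V' = crossing V' V.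
Proof.
by apply: eq_existsb => a; apply: eq_existsb => b; apply: eq_existsb => c;
  apply: eq_existsb => e; rewrite orbC .
Qed.

Lemma crossing_irr V : crossing V V = false.
Proof.
apply/negbTE/negP => /existsP[a] /existsP[b] /existsP[c] /existsP[e] /and4P[h1 h2 h3].
have ac := ltn_trans h1 h2; have be := ltn_trans h2 h3.
by rewrite orbb => /andP[/eqP-> /eqP/set2_lt_inj[]// ab _];
  rewrite ab ltnn in h1.
Qed.

Lemma crossings0 : crossings (set0 : {set {set 'I_m}}) = 0%N.
Proof.
apply/eqP; rewrite cards_eq0; apply/eqP/setP => P; rewrite !inE.
by apply/negbTE/negP => /existsP[V]; rewrite inE.
Qed.

(** Crossing pairs split into those containing [V] and those inside [pi]; this isolates the share of
    the block removed in the recursion. *)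
Lemma crossingsU1 V pi : V \notin pi ->
  crossings (V |: pi) = (#|[set V' in pi | crossing V V']| + crossings pi)%N.
Proof.
move=> Vpi; pose N := [set V' in pi | crossing V V'].
have -> : #|[set V' in pi | crossing V V']| = #|[set [set V; V'] | V' in N]|.
  rewrite card_in_imset // => V1 V2; rewrite !inE => /andP[h1 _] /andP[h2 _] /setP.
  move=> /(_ V1); rewrite !inE eqxx orbT => /esym/orP[/eqP e|/eqP//].
  by rewrite -e h1 in Vpi.
rewrite /crossings -cardsUI [X in (_ = _ + X)%N](_ : _ = 0%N) ?addn0.
  congr #|pred_of_set _|; apply/setP => P; rewrite !inE; apply/idP/orP.
    case/existsP => V1 /andP[V1pi /existsP[V2 /andP[V2pi /andP[/eqP-> c]]]].
    move: V1pi V2pi c; rewrite !inE => /orP[/eqP->|h1] /orP[/eqP->|h2] c.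
    - by rewrite crossing_irr in c.
    - by left; apply/imsetP; exists V2 => //; rewrite inE h2.
    - by left; apply/imsetP; exists V1; rewrite 1?setUC // inE h1 crossingC.
    - right; apply/existsP; exists V1; rewrite h1; apply/existsP; exists V2.
      by rewrite h2 c eqxx.
  case=> [/imsetP[V']|/existsP[V1 /andP[h1 /existsP[V2 /andP[h2 c]]]]].
    rewrite inE => /andP[h c] ->; apply/existsP; exists V; rewrite setU11.
    by apply/existsP; exists V'; rewrite inE h orbT c eqxx.
  apply/existsP; exists V1; rewrite inE h1 orbT; apply/existsP; exists V2.
  by rewrite inE h2 orbT.
apply/eqP; rewrite cards_eq0; apply/eqP/setP => P; rewrite !inE.
apply/negbTE/negP => /andP[/imsetP[V' _ ->]].
case/existsP => V1 /andP[h1 /existsP[V2 /andP[h2 /andP[/eqP/setP/(_ V)]]]].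
rewrite !inE eqxx /= => /esym/orP[]/eqP e _.
  by rewrite e h1 in Vpi.
by rewrite e h2 in Vpi.
Qed.

Lemma crossings_permU1 (s : 'S_m) V pi : V \notin pi ->
  crossings (perm_partition s (V |: pi)) =
  (#|[set V' in pi | crossing (s @: V) (s @: V')]| + crossings (perm_partition s pi))%N.
Proof.
have sI : injective (fun V => s @: V) by apply/imset_inj/perm_inj.
move=> Vpi; rewrite /perm_partition imsetU1 crossingsU1; last first.
  by rewrite mem_imset.
set N := [set V' in pi | _]; rewrite -(card_imset (mem N) sI).
congr (_ + _)%N; apply: eq_card => V1.
rewrite inE; apply/andP/imsetP => [[/imsetP[V' h ->] c]|[V']].
  by exists V' => //; rewrite inE h.
by rewrite inE => /andP[h c] ->; rewrite mem_imset.
Qed.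

End Crossings.

(** * Crossings read in the order of the word *)

(** The inverse of [shuffle] on zero-based positions: the left letter [2j] goes to [j], the right
    letter [2j + 1] to [2n - 1 - j]. *)
Definition shuffle_pos n k : nat := if odd k then (n.*2 - uphalf k)%N else k./2.

Lemma shuffleVE n (x : 'I_(n.*2)) : (shuffle n)^-1%g x = shuffle_pos n x :> nat.
Proof.
have hx := ltn_ord x; have hxE := odd_double_half x.
have lt : (shuffle_pos n x < n.*2)%N by rewrite /shuffle_pos; case: ifP; lia.
have -> : x = shuffle n (Ordinal lt).
  apply: val_inj; rewrite permE /= /shuffle_nat /shuffle_pos uphalf_half.
  by move: hxE; do 2 case: ifP; lia.
rewrite permK permE /=; congr (shuffle_pos n _).
rewrite /shuffle_nat /shuffle_pos uphalf_half.
by move: hxE; do 2 case: ifP; lia.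
Qed.

(* The left-to-right order of the pending letters: each letter at an even (resp.
   odd) position is inserted on the left (resp. right). *)
Definition deque_lt : rel nat :=
  fun x y => if odd x then odd y && (x < y)%N else odd y || (y < x)%N.

Lemma deque_lt_irr : irreflexive deque_lt.
Proof. by move=> x; rewrite /deque_lt !ltnn; case: odd. Qed.

Lemma deque_lt_asym : antisymmetric deque_lt.
Proof. by move=> x y; rewrite /deque_lt; case: (odd x); case: (odd y) => //=; lia. Qed.

(* The letters which [t] crosses when it is paired with x. *)
Definition passed (t x y : nat) : bool := if odd t then deque_lt x y else deque_lt y x.

(** Letters before [t] occupy both ends of the unshuffled line, [t] takes the next free place on its
    side, and [h] falls into the gap that remains. Closing the line to a circle and reading it
    backwards from the gap gives the deque with [t] at an end, so the blocks cross exactly when [y]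
    lies between [x] and [t] there. *)
Lemma crossing_passed n (x t y h : 'I_(n.*2)) :
  (x < t)%N -> (y < t)%N -> (t < h)%N -> x != y ->
  crossing ((shuffle n)^-1%g @: [set x; t]) ((shuffle n)^-1%g @: [set y; h]) = passed t x y.
Proof.
rewrite -(inj_eq val_inj) /= => xt yt th xy; rewrite !imsetU1 !imset_set1.
rewrite crossing_set2; last first.
  by rewrite -[[:: _; _; _; _]]/(map _ [:: x; t; y; h]) map_inj_uniq; [
    rewrite /= !inE -!(inj_eq val_inj) /=; lia | apply: perm_inj].
rewrite !shuffleVE /shuffle_pos !uphalf_half /passed /deque_lt.
have := ltn_ord h.
move: (odd_double_half x) (odd_double_half t) (odd_double_half y) (odd_double_half h).
by case: (odd x); case: (odd t); case: (odd y); case: (odd h) => /=; lia.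
Qed.

(** Both [y] and [h] fall into the gap left after [t], so [x] and [t] do not separate them. *)
Lemma crossing_later n (x t y h : 'I_(n.*2)) :
  (x < t)%N -> (t < y)%N -> (t < h)%N -> (y < h)%N ->
  crossing ((shuffle n)^-1%g @: [set x; t]) ((shuffle n)^-1%g @: [set y; h]) = false.
Proof.
move=> xt ty th yh; rewrite !imsetU1 !imset_set1.
rewrite crossing_set2; last first.
  by rewrite -[[:: _; _; _; _]]/(map _ [:: x; t; y; h]) map_inj_uniq; [
    rewrite /= !inE -!(inj_eq val_inj) /=; lia | apply: perm_inj].
rewrite !shuffleVE /shuffle_pos !uphalf_half.
have := ltn_ord h.
move: (odd_double_half x) (odd_double_half t) (odd_double_half y) (odd_double_half h).
by case: (odd x); case: (odd t); case: (odd y); case: (odd h) => /=; lia.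
Qed.

(** * Pairings of creations with later annihilations *)

Section Pairings.
Variables (m : nat) (eps : {ffun 'I_m -> bool}).
Implicit Types (A V : {set 'I_m}) (W : {set {set 'I_m}}).

Definition admissible V : bool :=
  [exists x : 'I_m, exists t : 'I_m,
    [&& (x < t)%N, eps x, ~~ eps t & V == [set x; t]]].

(** The ground set [A] varies because the recursion deletes the two positions of a block. *)
Definition pairing A W : bool := finset.partition W A && [forall V in W, admissible V].

Lemma admissibleP V : reflect
  (exists x t : 'I_m, [/\ (x < t)%N, eps x, ~~ eps t & V = [set x; t]]) (admissible V).
Proof.
apply: (iffP existsP) => [[x /existsP[t /and4P[? ? ? /eqP ?]]]|[x [t [? ? ? ->]]]].
  by exists x, t.
by exists x; apply/existsP; exists t; apply/and4P.
Qed.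

Lemma admissible_eq x t : eps x -> ~~ eps t -> admissible [set x; t] -> (x < t)%N.
Proof.
move=> ex et /admissibleP[y [h [yh ey eh /setP eq]]].
have := eq x; have := eq t; rewrite !inE !eqxx orbT /=.
move=> /esym/orP[]/eqP e1 /esym/orP[]/eqP e2; subst => //.
- by rewrite ey in et.
- by rewrite ey in et.
- by rewrite ex in eh.
Qed.

Lemma pairing_block A W y : pairing A W -> y \in A ->
  exists x t, [/\ [set x; t] \in W, (x < t)%N, eps x, ~~ eps t & y = (if eps y then x else t)].
Proof.
case/andP => pW /forall_inP aW yA.
have yc : y \in cover W by rewrite (cover_partition pW).
have bW := pblock_mem yc; have /admissibleP[x [t [xt ex et eq]]] := aW _ bW.
exists x, t; rewrite -eq; split => //.
by move: yc; rewrite -mem_pblock eq !inE => /orP[]/eqP->; rewrite ?ex ?(negbTE et).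
Qed.

Lemma pairing_sub A W x t : pairing A W -> [set x; t] \in W -> x \in A /\ t \in A.
Proof.
case/andP => pW _ h; have := partitionS pW h.
by rewrite subUset !sub1set => /andP[].
Qed.

Lemma partition_block_eq A W (V V' : {set 'I_m}) y : finset.partition W A ->
  V \in W -> V' \in W -> y \in V -> y \in V' -> V = V'.
Proof.
by case/and3P => _ tW _ VW V'W yV yV'; rewrite -(def_pblock tW VW yV) (def_pblock tW V'W yV').
Qed.

(** Prepares the reindexing of the pairings that contain a given block by the pairings of the
    remaining positions. *)
Lemma pairingD1 A W x t : x \in A -> t \in A -> (x < t)%N -> eps x -> ~~ eps t ->
  pairing A ([set x; t] |: W) && ([set x; t] \notin W) = pairing (A :\: [set x; t]) W.
Proof.
move=> xA tA xt ex et; set X := [set x; t].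
have XA : X \subset A by rewrite subUset !sub1set xA.
have X0 : X != set0 by apply/set0Pn; exists x; rewrite !inE eqxx.
apply/idP/idP => [/andP[/andP[pW /forall_inP aW] XW]|/andP[pW /forall_inP aW]].
  apply/andP; split.
    by rewrite -{1}(setU1K XW) partitionD1 // setU11.
  by apply/forall_inP => V VW; rewrite aW // setU1r.
apply/andP; split; last first.
  apply/negP => /(partitionS pW) /subsetP/(_ x).
  by rewrite !inE eqxx /= => /(_ isT).
apply/andP; split.
  have -> : A = X :|: A :\: X by rewrite -{1}(setIidPr XA) setID.
  by rewrite partitionU1 // disjoints_subset setCD subsetUr.
apply/forall_inP => V; rewrite !inE => /orP[/eqP->|/aW//].
by apply/admissibleP; exists x, t.
Qed.

End Pairings.

(** * The recursion for the sum over pairings *)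

Section PairingSum.
Variables (R : realType) (d n : nat) (q : R).
Variables (eps : {ffun 'I_(n.*2) -> bool}) (u : 'I_(n.*2) -> 'rV[R[i]]_d).
Local Notation C := R[i].
Implicit Types (A V : {set 'I_(n.*2)}) (W : {set {set 'I_(n.*2)}}).

(** [W] lives on the positions of the word, that is after the shuffle; crossings are counted after
    undoing it. *)
Definition pairing_weight W : C :=
  q%:C ^+ crossings (perm_partition (shuffle n)^-1%g W) *
  \prod_(p : 'I_(n.*2) * 'I_(n.*2) | [&& [set p.1; p.2] \in W, ~~ eps p.2 & eps p.1])
    cdot (u p.1) (u p.2).

Definition pairing_sum A : C := \sum_(W | pairing eps A W) pairing_weight W.

Lemma pairing_sum0 : pairing_sum set0 = 1.
Proof.
rewrite /pairing_sum (big_pred1 set0) => [|W].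
  rewrite /pairing_weight /perm_partition imset0 crossings0 expr0 mul1r big_pred0 // => p.
  by rewrite inE.
rewrite /pairing partition_set0 inE; case: eqP => [->|//].
by apply/forall_inP => V; rewrite inE.
Qed.

(** Since [t] is the first annihilation of [A], all other blocks close after [t]. Those opening
    after [t] do not cross its block, and each remaining [y] before [t] determines one block, to
    which [crossing_passed] applies. *)
Lemma card_crossing_passed A W x t : x \in A -> t \in A -> (x < t)%N -> ~~ eps t ->
  (forall y, y \in A -> (y < t)%N -> eps y) ->
  pairing eps (A :\: [set x; t]) W ->
  #|[set V in W | crossing ((shuffle n)^-1%g @: [set x; t]) ((shuffle n)^-1%g @: V)]| =
  #|[set y in A | (y < t)%N && passed t x y]|.
Proof.
move=> xA tA xt et first pW.
have [pW' aW] := andP pW.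
have block V : V \in W -> exists y h : 'I_(n.*2), [/\ V = [set y; h], (y < h)%N,
    (t < h)%N, y \in A & (y != x) && (y != t)].
  move=> VW; have /forall_inP/(_ _ VW)/admissibleP[y [h [yh ey eh e]]] := aW.
  exists y, h; move: VW; rewrite e => /(pairing_sub pW); rewrite !inE !negb_or.
  case=> /andP[-> yA] /andP[/andP[_ ht] hA]; split => //.
  rewrite ltn_neqAle eq_sym ht leqNgt; apply: contra eh; exact: first.
have tW := partition_trivIset pW'.
have opener_block y : y \in A -> (y < t)%N -> y != x ->
    exists h : 'I_(n.*2), [/\ [set y; h] \in W, (y < h)%N & (t < h)%N].
  move=> yA yt yx; have yD : y \in A :\: [set x; t].
    by rewrite !inE negb_or yx yA andbT; apply: contraTneq yt => ->; rewrite ltnn.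
  have [z [h [VW zh ez eh]]] := pairing_block pW yD; rewrite first // => e; subst z.
  exists h; split=> //; have [y' [h' [eV y'h' th' _ _]]] := block _ VW.
  by have [_ ->] := set2_lt_inj zh y'h' eV.
rewrite -[RHS](@card_in_imset _ _ (pblock W)).
  apply: eq_card => V; rewrite inE; apply/andP/imsetP => [[VW]|[y]].
    have [y [h [eV yh th yA /andP[yx yt]]]] := block V VW; rewrite eV => c.
    exists y; last by rewrite (def_pblock tW VW) // eV !inE eqxx.
    rewrite inE yA /=; case: (ltngtP y t) => [yt'|ty|/val_inj e]; last by rewrite e eqxx in yt.
      by rewrite -(@crossing_passed n x t y h) // eq_sym.
    by rewrite crossing_later in c.
  rewrite inE => /and3P[yA yt py].
  have yx : y != x by apply: contraTneq py => ->; rewrite /passed deque_lt_irr if_same.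
  have [h [VW yh th]] := opener_block y yA yt yx.
  move=> ->; rewrite (def_pblock tW VW) ?inE ?eqxx //; split=> //.
  by rewrite crossing_passed // eq_sym.
move=> y y'; rewrite !inE => /and3P[yA yt py] /and3P[yA' yt' py'].
have yx : y != x by apply: contraTneq py => ->; rewrite /passed deque_lt_irr if_same.
have yx' : y' != x by apply: contraTneq py' => ->; rewrite /passed deque_lt_irr if_same.
have [h [VW yh th]] := opener_block y yA yt yx.
have [h' [VW' yh' th']] := opener_block y' yA' yt' yx'.
rewrite (def_pblock tW VW) ?inE ?eqxx // (def_pblock tW VW') ?inE ?eqxx //.
by case/set2_lt_inj.
Qed.

(** Pairings are sorted by the partner [x] of [t]. Deleting the block of [t] leaves a pairing of the
    rest and takes off one [q] for each block crossing it. *)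
Lemma pairing_sum_rec A t : t \in A -> ~~ eps t ->
  (forall y, y \in A -> (y < t)%N -> eps y) ->
  pairing_sum A = \sum_(x in A | (x < t)%N)
    q%:C ^+ #|[set y in A | (y < t)%N && passed t x y]| * cdot (u x) (u t) *
    pairing_sum (A :\: [set x; t]).
Proof.
move=> tA et first.
transitivity (\sum_(W | pairing eps A W) \sum_(x | (x \in A) && (x < t)%N && ([set x; t] \in W))
    pairing_weight W).
  apply: eq_bigr => W pW.
  have [x [h [XW xh ex _]]] := pairing_block pW tA; rewrite (negbTE et) => th; subst h.
  have [xA _] := pairing_sub pW XW.
  rewrite (big_pred1 x) // => y /=; apply/idP/eqP => [/andP[/andP[yA yt] YW]|->]; last first.
    by rewrite xA xh XW.
  have /set2_lt_inj[]// : [set y; t] = [set x; t].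
  by apply: (partition_block_eq (andP pW).1 YW XW (y := t)); rewrite !inE eqxx orbT.
rewrite (exchange_big_dep (fun x => (x \in A) && (x < t)%N)) /=; last by move=> W x _ /andP[].
apply: eq_bigr => x /andP[xA xt]; set X := [set x; t].
have ex := first x xA xt.
rewrite (reindex_onto (fun W => X |: W) (fun W => W :\ X)) /=; last first.
  by move=> W /andP[_ /andP[_ XW]]; rewrite setD1K.
rewrite mulr_sumr; apply: eq_big => [W|W].
  rewrite -pairingD1 // xA xt setU11 /= andbT; congr (_ && _).
  apply/eqP/idP => [<-|/setU1K//]; by rewrite !inE eqxx.
move=> h; have XW : X \notin W.
  by case/andP: h => _ /eqP <-; rewrite !inE eqxx.
have pW : pairing eps (A :\: X) W.
  by case/andP: h => /andP[h _] _; rewrite -pairingD1 // h.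
rewrite /pairing_weight crossings_permU1 // (card_crossing_passed _ _ _ _ _ pW) //.
rewrite (bigD1 (x, t)) /=; last by rewrite setU11 et ex.
rewrite exprD -!mulrA; congr (_ * _); rewrite mulrCA; congr (_ * (_ * _)).
apply: eq_bigl => -[y h'] /=; rewrite !inE xpair_eqE.
case: (boolP (eps y)) => ey; rewrite ?andbF //; case: (boolP (eps h')) => eh; rewrite ?andbF //=.
(* A pair spanning [[set x; t]] with these values of [eps] can only be [(x, t)], never [(t, x)]. *)
rewrite !andbT; case: eqP => [e|ne] /=.
  have yh' : (y < h')%N.
    by apply: (admissible_eq ey eh); rewrite e; apply/admissibleP; exists x, t.
  have [-> ->] := set2_lt_inj yh' xt e.
  by rewrite !eqxx /= (negbTE XW).
rewrite andb_idr // => _; apply/negP => /andP[/eqP e /eqP e']; apply: ne.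
by rewrite e e'.
Qed.

End PairingSum.

(** * The word acting letter by letter on elementary tensors *)

Section VacuumExpansion.
Variables (R : realType) (d n : nat) (q : R).
Variables (eps : {ffun 'I_(n.*2) -> bool}) (u : 'I_(n.*2) -> 'rV[R[i]]_d).
Local Notation C := R[i].
Implicit Types (f g : seq 'I_d -> C^o) (s ts : seq 'I_(n.*2)).

(** The letters act on all coefficient families, so that linearity can be used without
    summability. *)
Definition coef_letter (i : 'I_(n.*2)) f : seq 'I_d -> C^o :=
  if eps i then (if odd i then rcreate (u i) f else lcreate (u i) f)
  else if odd i then rannih q (u i) f else lannih q (u i) f.

Definition coef_word ts f := foldl (fun f i => coef_letter i f) f ts.

Lemma coef_letterD i f g : coef_letter i (f + g) = coef_letter i f + coef_letter i g.
Proof.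
rewrite /coef_letter /rannih !rcreateE !flipD !lannihD !lcreateD !flipD.
by case: ifP; case: ifP.
Qed.

Lemma coef_letterZ i (a : C) f : coef_letter i (a *: f) = a *: coef_letter i f.
Proof.
rewrite /coef_letter /rannih !rcreateE !flipZ !lannihZ !lcreateZ !flipZ.
by case: ifP; case: ifP.
Qed.

Lemma coef_wordD ts f g : coef_word ts (f + g) = coef_word ts f + coef_word ts g.
Proof. by elim: ts f g => //= i ts IH f g; rewrite coef_letterD IH. Qed.

Lemma coef_wordZ ts (a : C) f : coef_word ts (a *: f) = a *: coef_word ts f.
Proof. by elim: ts f => //= i ts IH f; rewrite coef_letterZ IH. Qed.

Lemma coef_word_sum ts s (c : 'I_(n.*2) -> C) (f : 'I_(n.*2) -> seq 'I_d -> C^o) :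
  coef_word ts (\sum_(x <- s) c x *: f x) = \sum_(x <- s) c x *: coef_word ts (f x).
Proof.
have w0 : coef_word ts 0 = 0 by rewrite -(scale0r (0 : seq 'I_d -> C^o)) coef_wordZ !scale0r.
rewrite (big_morph _ (coef_wordD ts) w0); apply: eq_bigr => x _; exact: coef_wordZ.
Qed.

(* [s] lists the letters still to be annihilated, in the order of the tensor factors. *)
Lemma coef_word_tensor ts s :
  pairwise (fun x y : 'I_(n.*2) => x < y)%N ts ->
  pairwise (fun x y : 'I_(n.*2) => deque_lt x y) s ->
  all eps s -> allrel (fun x y : 'I_(n.*2) => x < y)%N s ts ->
  (size s + count eps ts = count (fun i => ~~ eps i) ts)%N ->
  coef_word ts (tensor (map u s)) = pairing_sum q eps u [set x in s ++ ts] *: tensor [::].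
Proof.
pose lt (x y : 'I_(n.*2)) := deque_lt x y.
have ltI : irreflexive lt by move=> x; exact: deque_lt_irr.
have ltA : antisymmetric lt by move=> x y /deque_lt_asym/val_inj.
elim: ts s => [|t ts IH] s.
  move=> _ _ _ _ /=; rewrite addn0 => /size0nil ->.
  rewrite (_ : [set x in [::] ++ [::]] = set0); last by apply/setP => x; rewrite !inE.
  by rewrite pairing_sum0 scale1r.
move=> /andP[tts pts] ps es; rewrite allrel_consr => /andP[st sts].
rewrite -[coef_word _ _]/(coef_word ts (coef_letter t _)) {1}/coef_letter
  [count _ (_ :: _)]/= [count _ (_ :: _)]/=.
case: (boolP (eps t)) => et.
  rewrite add0n add1n addnS => bal.
  (* A creation only moves [t] from the word to its end of the deque; the set of positions, and
     hence the pairing sum, stays the same. *)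
  have -> : [set x in s ++ t :: ts] = [set x in (if odd t then rcons s t else t :: s) ++ ts].
    apply/setP => x; case: ifP => _; rewrite !inE !mem_cat ?mem_rcons !inE //.
      by rewrite orbCA orbA.
    by rewrite orbCA orbA.
  have -> : (if odd t then rcreate (u t) (tensor (map u s)) else lcreate (u t) (tensor (map u s)))
      = tensor (map u (if odd t then rcons s t else t :: s)).
    by case: ifP; rewrite ?rcreate_tensor ?lcreate_tensor ?map_rcons.
  apply: IH => //.
  - case: ifP => ot; rewrite ?pairwise_rcons /= ps andbT; apply/allP => y /(allP st) yt.
      by rewrite /deque_lt ot yt; case: odd.
    by rewrite /deque_lt ot yt orbT.
  - by case: ifP; rewrite ?all_rcons /= et es.
  - case: ifP => _; last by rewrite allrel_consl tts.
    by rewrite -cats1 allrel_catl sts allrel1l.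
  - by case: ifP => _; rewrite ?size_rcons.
rewrite add0n add1n => bal.
set A := [set x in _].
have us : uniq s := pairwise_uniq ltI ps.
(* The elements of [A] before [t] are exactly the pending letters, all creations, so [t] is the
   first annihilation in [A]. *)
have AE x : (x \in A) && (x < t)%N = (x \in s).
  rewrite inE mem_cat inE; case: (boolP (x \in s)) => [xs|_] /=; first exact: allP st _ xs.
  apply/negP => /andP[/orP[/eqP->|/(allP tts)]]; last by move=> tx; rewrite ltnNge (ltnW tx).
  by rewrite ltnn.
have tA : t \in A by rewrite inE mem_cat mem_head orbT.
have -> : (if odd t then rannih q (u t) (tensor (map u s)) else lannih q (u t) (tensor (map u s)))
   = \sum_(x <- s) (q%:C ^+ #|[set y in A | (y < t)%N && passed t x y]| * cdot (u x) (u t)) *: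
       tensor (map u [seq y <- s | y != x]).
  have cE (P : pred 'I_(n.*2)) : count P s = #|[set y in A | (y < t)%N && P y]|.
    rewrite -size_filter -(card_uniqP (filter_uniq P us)); apply: eq_card => y.
    by rewrite mem_filter !inE andbA -AE andbC !inE.
  case: ifP => ot; rewrite (@rannih_tensor _ _ _ _ lt, @lannih_tensor _ _ _ _ lt) //;
    by apply: eq_bigr => x _; rewrite cE /passed ot.
rewrite coef_word_sum (@pairing_sum_rec _ _ _ _ _ _ _ _ tA et); last first.
  by move=> y yA yt; apply: (allP es); rewrite -AE yA.
rewrite scaler_suml [RHS](eq_bigl (mem s)) => [|x]; last by rewrite AE.
rewrite -[RHS]big_uniq //=; apply: eq_big_seq => x xs.
rewrite -[RHS]scalerA; congr (_ *: _).
have xt := allP st _ xs.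
rewrite IH.
- congr (pairing_sum _ _ _ _ *: _); apply/setP => y.
  rewrite !inE !mem_cat mem_filter inE negb_or; case: (eqVneq y x) => [->|yx] /=.
    by apply/negP => /(allP tts); rewrite ltnNge (ltnW xt).
  case: (eqVneq y t) => [->|yt] //=.
  apply/negP => /orP[/(allP st)|/(allP tts)]; by rewrite ltnn.
- by [].
- exact: pairwise_filter.
- by apply/allP => y; rewrite mem_filter => /andP[_ /(allP es)].
- by apply/allrelP => y z; rewrite mem_filter => /andP[_ ys] zts; exact: (allrelP sts).
(* Both sides of the balance drop by one: [s] loses [x] and the word loses the annihilation [t]. *)
- rewrite -(rem_filter x us) size_rem //; move: bal.
  by case: (s) xs => // y s' _ /=; lia.
Qed.

End VacuumExpansion.

(** * From coefficients to vectors of the Fock space *)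

Section Words.
Variables (R : realType) (d n : nat) (q : R) (hq : -1 < q < 1).
Variables (eps : {ffun 'I_(n.*2) -> bool}) (u : 'I_(n.*2) -> 'rV[R[i]]_d).

Lemma coef_letterE i (x : fock d hq) :
  coef (letter eps u i x) = coef_letter q eps u i (coef x).
Proof.
rewrite /letter /coef_letter; case: ifP => _; case: ifP => _ //.
  by rewrite coef_adjoint_right.
by rewrite coef_adjoint_left.
Qed.

Lemma coef_alternating_word (x : fock d hq) :
  coef (alternating_word eps u x) = coef_word q eps u (enum 'I_(n.*2)) (coef x).
Proof.
suff H s (B : fock d hq -> fock d hq) :
    coef (foldl (fun A i => letter eps u i \o A) B s x) = coef_word q eps u s (coef (B x)).
  exact: H.
elim: s B => [//|i s IH] B; rewrite [LHS]IH /= coef_letterE //.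
Qed.

End Words.

(** * Pairings and the fibre of [Phi] *)

Section Encoding.
Variables (m : nat).
Implicit Types (pi : {set {set 'I_m}}) (s : 'S_m).

Lemma perm_partitionK s : cancel (perm_partition s) (perm_partition s^-1%g).
Proof.
move=> pi; rewrite /perm_partition -imset_comp -[RHS]imset_id; apply: eq_imset => V /=.
rewrite -imset_comp -[RHS]imset_id; apply: eq_imset => x /=; exact: permK.
Qed.

Lemma is_pair_partition_perm s pi :
  is_pair_partition (perm_partition s pi) = is_pair_partition pi.
Proof.
rewrite /is_pair_partition; congr (_ && _).
  rewrite -[RHS](imset_partition _ _ (@perm_inj _ s)); congr (finset.partition _ _).
  apply/setP => x; rewrite !inE; apply/esym/imsetP; exists (s^-1%g x) => //.
  by rewrite permKV.
apply/forall_inP/forall_inP => h V Vpi.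
  by rewrite -(card_imset _ (@perm_inj _ s)) h // imset_f.
by case/imsetP: Vpi => V' /h c ->; rewrite card_imset //; exact: perm_inj.
Qed.

End Encoding.

Lemma Phi_pair n (pi : {set {set 'I_(n.*2)}}) (x t : 'I_(n.*2)) :
  is_pair_partition pi -> [set x; t] \in perm_partition (shuffle n) pi -> (x < t)%N ->
  Phi pi x = true /\ Phi pi t = false.
Proof.
rewrite -(is_pair_partition_perm (shuffle n)) => /andP[pW _] XW xt; rewrite !ffunE; split.
  apply/existsP; exists [set x; t]; rewrite XW !inE eqxx /=.
  by apply/forall_inP => j; rewrite !inE => /orP[]/eqP-> //; exact: ltnW.
apply/negbTE/negP => /existsP[V /and3P[VW tV /forall_inP/(_ x)]].
rewrite (partition_block_eq pW VW XW tV) ?inE ?eqxx ?orbT //= => /(_ isT).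
by rewrite leqNgt xt.
Qed.

(** [Phi] marks the minima of the shuffled blocks, so for a pair partition it equals [eps] exactly
    when every shuffled block is a creation followed by an annihilation. *)
Lemma pairing_PhiE n (eps : {ffun 'I_(n.*2) -> bool}) (pi : {set {set 'I_(n.*2)}}) :
  pairing eps setT (perm_partition (shuffle n) pi) =
    is_pair_partition pi && (Phi pi == eps).
Proof.
apply/idP/andP => [pW|[pp /eqP <-]].
  have pp : is_pair_partition pi.
    rewrite -(is_pair_partition_perm (shuffle n)); case/andP: pW => pW /forall_inP aW.
    rewrite /is_pair_partition pW /=.
    apply/forall_inP => V /aW/admissibleP[x [t [xt _ _ ->]]].
    by rewrite cards2; case: (eqVneq x t) xt => [->|//]; rewrite ltnn.
  split=> //; apply/eqP/ffunP => i.
  have [x [t [XW xt ex et ei]]] := pairing_block pW (in_setT i).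
  have [px pt] := Phi_pair pp XW xt.
  by rewrite ei; case: ifP; rewrite ?px ?pt ?ex ?(negbTE et).
have := pp; rewrite -{1}(is_pair_partition_perm (shuffle n)) => /andP[pW /forall_inP cW].
rewrite /pairing pW /=; apply/forall_inP => V VW.
have /cards2P[x [t [xt eV]]] := cW _ VW.
wlog lt : x t xt eV / (x < t)%N.
  move=> H; case: (ltngtP x t) => [|tx|e]; first exact: H.
    by apply: (H t x) => //; rewrite 1?eq_sym // setUC.
  by rewrite (val_inj e) eqxx in xt.
rewrite eV in VW *; have [px pt] := Phi_pair pp VW lt.
by apply/admissibleP; exists x, t; rewrite px pt.
Qed.

Theorem proposition3p2p6 (R : realType) (d n : nat) (q : R)
  (hd : (0 < d)%N) (hn : (0 < n)%N) (hq : -1 < q < 1)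
  (eps : {ffun 'I_(n.*2) -> bool}) (heps : dyck eps)
  (u : 'I_(n.*2) -> 'rV[R[i]]_d) :
  alternating_word eps u (vac d hq) =
  (\sum_(pi : {set {set 'I_(n.*2)}} | is_pair_partition pi && (Phi pi == eps))
     q%:C ^+ crossings pi *
     \prod_(p : 'I_(n.*2) * 'I_(n.*2) |
              [&& [set p.1; p.2] \in perm_partition (shuffle n) pi,
                  ~~ eps p.2 & eps p.1])
       cdot (u p.1) (u p.2)) *: vac d hq.
Proof.
apply: val_inj; rewrite [LHS]coef_alternating_word.
have vacE : coef (vac d hq) = tensor [::] by apply/funext => w; rewrite tensor_nil.
transitivity (pairing_sum q eps u setT *: coef (vac d hq)).
  rewrite vacE -[tensor [::]]/(tensor (map u [::])) coef_word_tensor //.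
  - by congr (pairing_sum _ _ _ _ *: _); apply/setP => x; rewrite !inE mem_enum.
  - rewrite -sorted_pairwise; last by move=> x y z; exact: ltn_trans.
    by have := iota_ltn_sorted 0 n.*2; rewrite -val_enum_ord sorted_map.
  (* The balance of creations and annihilations is the closing equality in [dyck]. *)
  - have countE (P : pred 'I_(n.*2)) : count P (enum 'I_(n.*2)) = #|[set i | P i]|.
      rewrite -size_filter -(card_uniqP (filter_uniq P (enum_uniq _))).
      by apply: eq_card => i; rewrite mem_filter mem_enum !inE andbT.
    by case/andP: heps => _ /eqP; rewrite !countE.
(* Reindexing by the shuffle makes the inverse shuffle in [pairing_weight] cancel. *)
congr (_ *: _); rewrite /pairing_sum (reindex_inj (can_inj (perm_partitionK (shuffle n)))) /=.
apply: eq_big => [pi|pi _]; first exact: pairing_PhiE.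
by rewrite /pairing_weight perm_partitionK.
Qed.
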